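(* Let $(Z,\omega)$ be a symplectic vector space with Lagrangian subspaces $X,Y$ such that $Z=X\oplus Y$. Let $(\alpha,\beta)$ be a Fredholm pair of index $0$ of Lagrangian subspaces of $Z$. View $\alpha,\beta$ as linear relations from $X$ to $Y$. Set $W_1:=\alpha\cap Y$, $W_2:=\beta\cap Y$, $\gamma:=W_1^\omega\cap X+W_1$, and $\delta:=W_2^\omega\cap X+W_2$. Assume that $\dim Y/(W_1+W_2)<+\infty$. Then the following hold. (a) The linear subspaces $W_1$, $W_2$, $X+W_1$, $X+W_2$, $W_1+W_2$, $W_1^\omega\cap X+W_2^\omega\cap X$, $\operatorname{dom}(\alpha)=W_1^\omega\cap X$, $\operatorname{dom}(\beta)=W_2^\omega\cap X$, $\alpha+Y=W_1^\omega$, $\beta+Y=W_2^\omega$ are $\omega$-closed (and these equalities hold). Moreover, $(\gamma,\delta)$ is a Fredholm pair of index $0$ of Lagrangian subspaces of $Z$, and $$\dim Y/(W_1+W_2)=\dim(W_1^\omega\cap W_2^\omega\cap X),\qquad \dim(W_1\cap W_2)=\dim X/(W_1^\omega\cap X+W_2^\omega\cap X).$$ (b) If $(Z,\omega)$ is a symplectic Banach space, then $W_1^{\omega}\cap X$, $W_2^{\omega}\cap X$, $W_1^{\omega}\cap W_2^{\omega}\cap X$, $W_1^\omega\cap X+W_2^\omega\cap X$ are complemented closed linear subspaces of $X$, and $W_1$, $W_2$, $W_1\cap W_2$, $W_1+W_2$ are complemented closed linear subspaces of $Y$. (c) Set $W:=(W_1+W_2)^{\omega}$. Let $U$, $V$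 be two isotropic subspaces of $Z$. Assume that $\operatorname{dom}(U)=W_1^\omega\cap X$ and $\operatorname{dom}(V)=W_2^\omega\cap X$. Then $W_1^{\omega}=U+Y$, $W_2^{\omega}=V+Y$, $(U+V)\cap W=U\cap W+V\cap W$, $U\cap Y\subset W_1+W_2$, $V\cap Y\subset W_1+W_2$, $\dim R_W(Z)=2\dim Y/(W_1+W_2)$, $R_W(U)$ and $R_W(V)$ are Lagrangian subspaces of $R_W(Z)$, $U+V+W=W_1^\omega\cap X+W_2^\omega\cap X+Y$, and $$\dim Z/(U+V+W)=\dim(W_1\cap W_2)\ge\dim(U\cap V\cap Y).$$ If in addition $U\cap Y+V\cap Y\supset W_1+W_2$ and $\dim(U\cap V\cap Y)=\dim(W_1\cap W_2)$, then $U\cap Y+V\cap Y=W_1+W_2$ and $(U,V)$ is a Fredholm pair of index $0$ of Lagrangian subspaces of $Z$.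
   Context: A symplectic form on a complex vector space $Z$ is a non-degenerate sesquilinear form $\omega$ with $\omega(y,x)=-\overline{\omega(x,y)}$; a symplectic Banach space is a Banach space with a bounded symplectic form. For a subspace $\lambda$, $\lambda^\omega=\{x:\omega(x,y)=0\ \forall y\in\lambda\}$; $\lambda$ is isotropic if $\lambda\subset\lambda^\omega$, coisotropic if $\lambda\supset\lambda^\omega$, Lagrangian if $\lambda=\lambda^\omega$, and $\omega$-closed if $\lambda^{\omega\omega}=\lambda$. A pair $(\lambda,\mu)$ of subspaces is Fredholm if $\dim(\lambda\cap\mu)<\infty$ and $\dim Z/(\lambda+\mu)<\infty$, with index $\dim(\lambda\cap\mu)-\dim Z/(\lambda+\mu)$. Viewing a subspace $\lambda\subset Z=X\oplus Y$ as a linear relation from $X$ to $Y$, $\operatorname{dom}(\lambda)=\{x\in X:\exists y\in Y,\ x+y\in\lambda\}$. Symplectic reduction: for a coisotropic subspace $W$, the space $W/W^\omega$ carries the induced symplectic form $\tilde\omega(x+W^\omega,y+W^\omega)=\omega(x,y)$, and for any subspace $\lambda$ of $Z$, $R_W(\lambda):=(\lambda\cap W+W^\omega)/W^\omega$; in particular $R_W(Z)=W/W^\omega$. *)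

(* Defs.v *)
From HB Require Import structures.
From mathcomp Require Import all_boot all_order all_algebra generic_quotient.
From mathcomp Require Import ring_quotient sesquilinear complex.
From mathcomp Require Import all_classical all_reals all_analysis.
Set Implicit Arguments.
Unset Strict Implicit.
Unset Printing Implicit Defensive.
Import Order.TTheory GRing.Theory Num.Theory.
Import numFieldNormedType.Exports.
Local Open Scope classical_set_scope.
Local Open Scope ring_scope.

Definition lsubspace (K : nzRingType) (V : lmodType K) (A : set V) : Prop :=
  GRing.submod_closed (mem A).

Definition set_add (V : zmodType) (A B : set V) : set V :=
  [set a + b | a in A & b in B].

Notation "A :+: B" := (set_add A B)
  (at level 52, left associativity) : classical_set_scope.

Section QuotientSpace.
Variables (K : nzRingType) (V : lmodType K) (B : set V).

(* The span makes the quotient total in B; it is B itself whenever B is a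
   linear subspace, see lspan_id. *)
Definition lspan : {pred V} := [pred x | x \in smallest (@lsubspace K V) B].

Lemma lspan_submod_closed : GRing.submod_closed lspan.
Proof.
have memE x : (x \in lspan) = (x \in smallest (@lsubspace K V) B) by [].
split; first by rewrite memE inE => A [[A0 _] _]; apply: set_mem.
move=> a x y; rewrite !memE !inE => Hx Hy A HA; case: (HA) => -[_ HAl] _.
by apply/set_mem/HAl; apply/mem_set; [apply: Hx | apply: Hy].
Qed.

HB.instance Definition _ := GRing.isSubmodClosed.Build K V lspan lspan_submod_closed.

Lemma lspan_id x : lsubspace B -> (x \in lspan) = (x \in B).
Proof. by move=> sB; rewrite -[LHS]/(x \in smallest (@lsubspace K V) B) smallest_id. Qed.

Definition quotv := Quotient.quot lspan.

HB.instance Definition _ := GRing.Zmodule.on quotv.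
HB.instance Definition _ := EqQuotient.on quotv.

Definition piv (x : V) : quotv := (\pi_quotv x)%qT.

Lemma pivP x y : (piv x = piv y) <-> (x - y \in lspan).
Proof.
by rewrite /piv (Quotient.idealrBE lspan); split => [->|/eqP].
Qed.

Lemma pivD x y : piv (x + y) = piv x + piv y.
Proof. exact: (@pi_addr _ _ _ _ _ (Quotient.quot lspan)). Qed.

Definition scalev (a : K) (p : quotv) : quotv := piv (a *: repr p).

Lemma scalev_piv a x : scalev a (piv x) = piv (a *: x).
Proof.
apply/pivP; rewrite -scalerBr rpredZ //; apply/pivP.
by rewrite {1}/piv reprK.
Qed.

Lemma piv_repr p : piv (repr p) = p. Proof. exact: reprK. Qed.

Lemma scalevA a b p : scalev a (scalev b p) = scalev (a * b) p.
Proof. by rewrite -(piv_repr p) !scalev_piv scalerA. Qed.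

Lemma scale1v p : scalev 1 p = p.
Proof. by rewrite -(piv_repr p) scalev_piv scale1r. Qed.

Lemma scalevDr : right_distributive scalev +%R.
Proof.
by move=> a p q; rewrite -(piv_repr p) -(piv_repr q) -pivD !scalev_piv -pivD scalerDr.
Qed.

Lemma scalevDl p : {morph scalev^~ p : a b / a + b}.
Proof. by move=> a b /=; rewrite -(piv_repr p) !scalev_piv -pivD scalerDl. Qed.

HB.instance Definition _ :=
  GRing.Zmodule_isLmodule.Build K quotv scalevA scale1v scalevDr scalevDl.

Lemma piv_is_linear : linear piv.
Proof. by move=> a x y; rewrite pivD -scalev_piv. Qed.

HB.instance Definition _ := GRing.isLinear.Build K V quotv _ piv piv_is_linear.

End QuotientSpace.

Section Dimension.
Variables (R : realType) (V : lmodType R[i]).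

Definition is_basis (n : nat) (A : set V) (e : 'I_n -> V) : Prop :=
  [/\ forall i, A (e i),
      forall c : 'I_n -> R[i], \sum_i c i *: e i = 0 -> forall i, c i = 0
    & forall x, A x -> exists c : 'I_n -> R[i], x = \sum_i c i *: e i].

(* The cardinality of a finite basis, and +oo (the infimum of the empty set)
   if there is none. *)
Definition vdim (A : set V) : \bar R :=
  ereal_inf [set n%:R%:E | n in [set n | exists e : 'I_n -> V, is_basis A e]].

End Dimension.

(* dim A/B, where A/B is the image of A in V/B. *)
Definition qdim (R : realType) (V : lmodType R[i]) (A B : set V) : \bar R :=
  vdim (@piv _ V B @` A).

Section Fredholm.
Variables (R : realType) (V : lmodType R[i]).
Implicit Types A B : set V.

Definition fredholm_pair A B : Prop :=
  (vdim (A `&` B) < +oo)%E /\ (qdim [set: V] (A :+: B) < +oo)%E.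

Definition fredholm_index A B : \bar R :=
  (vdim (A `&` B) - qdim [set: V] (A :+: B))%E.

End Fredholm.

Definition direct_sum (V : zmodType) (E A B : set V) : Prop :=
  A :+: B = E /\ A `&` B = [set 0].

(* Linear in the first variable, conjugate-linear in the second one. *)
Notation "{ 'skew_hermitian' V }" := {hermitian V for true & Num.conj}
  (format "{ 'skew_hermitian'  V }") : ring_scope.

Section Forms.
Variables (R : realType) (V : lmodType R[i]) (w : V -> V -> R[i]).
Implicit Types A L : set V.

Definition nondegenerate_form : Prop :=
  forall x, (forall y, w x y = 0) -> x = 0.

Definition ann A : set V := [set x | forall y, A y -> w x y = 0].

Definition isotropic A : Prop := A `<=` ann A.
Definition coisotropic A : Prop := ann A `<=` A.
Definition lagrangian A : Prop := lsubspace A /\ A = ann A.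
Definition ann_closed A : Prop := ann (ann A) = A.

(* L is a Lagrangian subspace of the subspace E endowed with the restriction
   of w, whose values outside E are irrelevant. *)
Definition lagrangian_in (E L : set V) : Prop :=
  [/\ lsubspace L, L `<=` E & L = E `&` ann L].

End Forms.

Definition symplectic (R : realType) (V : lmodType R[i])
  (w : {skew_hermitian V}) : Prop := nondegenerate_form w.

Section Reduction.
Variables (R : realType) (V : lmodType R[i]).

(* The ambient type V/W^w contains W/W^w = reduction w W setT. *)
Definition reduction (w : V -> V -> R[i]) (W L : set V) :
    set (quotv (ann w W)) :=
  @piv _ V (ann w W) @` ((L `&` W) :+: ann w W).

(* Only meaningful on W/W^w, see reduced_formE. *)
Definition reduced_form (w : V -> V -> R[i]) (W : set V)
  (p q : quotv (ann w W)) : R[i] := w (repr p) (repr q).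

Lemma lsubspace_ann (w : {skew_hermitian V}) (W : set V) :
  lsubspace (ann w W).
Proof.
split; first by apply/mem_set => y _; rewrite linear0l.
move=> a x y /set_mem Hx /set_mem Hy; apply/mem_set => z Wz.
by rewrite linearPl /= Hx // Hy // mulr0 addr0.
Qed.

Lemma reduced_formE (w : {skew_hermitian V}) (W : set V) (x y : V) :
  coisotropic w W -> W x -> W y ->
  @reduced_form w W (piv (ann w W) x) (piv (ann w W) y) = w x y.
Proof.
move=> cW Wx Wy; rewrite /reduced_form.
have reprB z : ann w W (repr (piv (ann w W) z) - z).
  apply/set_mem; rewrite -lspan_id; last exact: lsubspace_ann.
  by apply/pivP; rewrite piv_repr.
set x' := repr _; set y' := repr _.
have Hx : ann w W (x' - x) := reprB x.
have Hy : ann w W (y' - y) := reprB y.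
have rann u v : W u -> ann w W v -> w u v = 0.
  by move=> Wu Wv; rewrite hermC Wv // rmorph0 mulr0.
rewrite -[x'](subrK x) -[y'](subrK y); move: (x' - x) (y' - y) Hx Hy => a b Ha Hb.
by rewrite linearDl !linearDr /= (Ha _ Wy) (Ha _ (cW _ Hb)) (rann _ _ Wx Hb) !add0r.
Qed.

End Reduction.
Arguments reduction {R V} w W L.
Arguments reduced_form {R V} w W p q.

(* The domain of L viewed as a linear relation from X to Y. *)
Definition relation_dom (V : zmodType) (X Y L : set V) : set V :=
  [set x | X x /\ exists2 y, Y y & L (x + y)].

Section Banach.
Variables (R : realType) (V : completeNormedModType R[i]).

Definition bounded_form (w : V -> V -> R[i]) : Prop :=
  exists M : R[i], forall x y, `|w x y| <= M * `|x| * `|y|.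

(* A is closed in E for the topology induced on E. *)
Definition closed_lsubspace_of (E A : set V) : Prop :=
  [/\ lsubspace A, A `<=` E & closed (A : set (subspace E))].

Definition complemented_closed_lsubspace_of (E A : set V) : Prop :=
  closed_lsubspace_of E A /\
  exists2 B, closed_lsubspace_of E B & direct_sum E A B.

End Banach.

Definition lagrangian_splitting_pair (R : realType) (Z : lmodType R[i])
    (w : {skew_hermitian Z}) (X Y alpha beta : set Z) : Prop :=
  [/\ symplectic w,
      lagrangian w X /\ lagrangian w Y,
      direct_sum [set: Z] X Y,
      lagrangian w alpha /\ lagrangian w beta
    & fredholm_pair alpha beta /\ fredholm_index alpha beta = 0%E].

(* Main.v *)
Require Import Defs.
From mathcomp Require Import all_boot all_order all_algebra zify.
From mathcomp Require Import sesquilinear complex.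
From mathcomp Require Import all_classical all_reals all_analysis.
Import Order.TTheory GRing.Theory Num.Theory.
Import numFieldNormedType.Exports.
Local Open Scope classical_set_scope.
Local Open Scope ring_scope.

(* The index formula for two subspaces U and V measured against a third one Y,
     dim(U & V) + dim Y/(U & Y + V & Y) + dim Z/(U + V + Y)
       = dim(U & V & Y) + dim((U + Y) & (V + Y))/Y + dim Z/(U + V),
   holds for arbitrary subspaces.  For U = alpha and V = beta the outer terms
   cancel because the index is 0, while duality bounds each of the two remaining
   terms on the right by the corresponding one on the left; so these bounds are
   equalities.  Hence W1 + W2 and alpha + beta + Y are w-closed and
   (alpha + Y) & (beta + Y) = W1^w & W2^w, and the modular law then forces
   alpha + Y = W1^w and beta + Y = W2^w.  Read backwards, the formula shows that
   every pair with the same sums with Y and the same traces on Y as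
   (alpha, beta) is Fredholm of index 0.  In the Banach case all complements can
   be chosen w-closed, and w-closed subspaces are topologically closed. *)

Set Implicit Arguments.
Unset Strict Implicit.
Unset Printing Implicit Defensive.

(** * Linear subspaces *)

Section Subspaces.
Variables (K : nzRingType) (V : lmodType K).
Implicit Types A B C : set V.

Lemma lsubspaceP A :
  A 0 -> (forall a x y, A x -> A y -> A (a *: x + y)) -> lsubspace A.
Proof.
move=> A0 AP; split; first exact/mem_set.
by move=> a x y /set_mem Ax /set_mem Ay; apply/mem_set/AP.
Qed.

Lemma lsub0 A : lsubspace A -> A 0.
Proof. by case=> /set_mem. Qed.

Lemma lsubP A a x y : lsubspace A -> A x -> A y -> A (a *: x + y).
Proof. by case=> _ AP Ax Ay; apply/set_mem/AP; apply/mem_set. Qed.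

Lemma lsubZ A a x : lsubspace A -> A x -> A (a *: x).
Proof.
by move=> sA Ax; rewrite -[_ *: _]addr0; apply: lsubP => //; apply: lsub0.
Qed.

Lemma lsubD A x y : lsubspace A -> A x -> A y -> A (x + y).
Proof. by move=> sA Ax Ay; rewrite -[x]scale1r; apply: lsubP. Qed.

Lemma lsubN A x : lsubspace A -> A x -> A (- x).
Proof. by move=> sA Ax; rewrite -scaleN1r; apply: lsubZ. Qed.

Lemma lsubB A x y : lsubspace A -> A x -> A y -> A (x - y).
Proof. by move=> sA Ax Ay; apply: lsubD => //; apply: lsubN. Qed.

Lemma lsub_sum A n (F : 'I_n -> V) : lsubspace A -> (forall i, A (F i)) ->
  A (\sum_i F i).
Proof.
by move=> sA AF; elim/big_ind: _ => //; [exact: lsub0|move=> *; apply: lsubD].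
Qed.

Lemma lsub_comb A n (c : 'I_n -> K) (e : 'I_n -> V) : lsubspace A ->
  (forall i, A (e i)) -> A (\sum_i c i *: e i).
Proof. by move=> sA Ae; apply: lsub_sum => // i; apply: lsubZ. Qed.

Lemma lsubspaceT : lsubspace [set: V].
Proof. exact: lsubspaceP. Qed.

Lemma lsubspace0 : lsubspace [set 0 : V].
Proof. by apply: lsubspaceP => // a x y -> ->; rewrite scaler0 addr0. Qed.

Lemma lsubspaceI A B : lsubspace A -> lsubspace B -> lsubspace (A `&` B).
Proof.
move=> sA sB; apply: lsubspaceP; first by split; exact: lsub0.
by move=> a x y [Ax Bx] [Ay By]; split; apply: lsubP.
Qed.

Lemma lsubspace_add A B : lsubspace A -> lsubspace B -> lsubspace (A :+: B).
Proof.
move=> sA sB; apply: lsubspaceP.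
  by exists 0; [exact: lsub0|exists 0; [exact: lsub0|rewrite addr0]].
move=> a _ _ [x Ax [y By <-]] [x' Ax' [y' By' <-]].
exists (a *: x + x'); first exact: lsubP.
by exists (a *: y + y'); [exact: lsubP|rewrite scalerDr addrACA].
Qed.

Lemma mem_add A B x y : A x -> B y -> (A :+: B) (x + y).
Proof. by move=> Ax By; exists x => //; exists y. Qed.

Lemma sub_addl A B : lsubspace B -> A `<=` A :+: B.
Proof.
by move=> sB x Ax; rewrite -[x]addr0; apply: mem_add => //; apply: lsub0.
Qed.

Lemma sub_addr A B : lsubspace A -> B `<=` A :+: B.
Proof.
by move=> sA x Bx; rewrite -[x]add0r; apply: mem_add => //; apply: lsub0.
Qed.

Lemma add_subset A B C : lsubspace C -> A `<=` C -> B `<=` C -> A :+: B `<=` C.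
Proof.
by move=> sC subA subB _ [a Aa [b Bb <-]]; apply: lsubD; [|exact: subA|exact: subB].
Qed.

Lemma set_addC A B : A :+: B = B :+: A.
Proof.
by apply/seteqP; split=> _ [a Aa [b Bb <-]]; rewrite addrC; apply: mem_add.
Qed.

Lemma set_addA A B C : A :+: (B :+: C) = A :+: B :+: C.
Proof.
apply/seteqP; split.
  by move=> _ [a Aa [_ [b Bb [c Cc <-]] <-]]; rewrite addrA; do 2?apply: mem_add.
by move=> _ [_ [a Aa [b Bb <-]] [c Cc <-]]; rewrite -addrA; do 2?apply: mem_add.
Qed.

Lemma set_add3 A B C : lsubspace A -> lsubspace B -> lsubspace C ->
  (A :+: C) :+: (B :+: C) = A :+: B :+: C.
Proof.
move=> sA sB sC; apply/seteqP; split.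
  apply: add_subset; first by do 2?apply: lsubspace_add.
    by move=> _ [a Aa [c Cc <-]]; apply: mem_add => //; apply: sub_addl.
  by move=> _ [b Bb [c Cc <-]]; apply: mem_add => //; apply: sub_addr.
move=> _ [_ [a Aa [b Bb <-]] [c Cc <-]]; rewrite -addrA.
by apply: mem_add; [apply: sub_addl|apply: mem_add].
Qed.

(** Dedekind's modular law: the [A]-part of an element of [C] already lies in [C], hence so does its
    [B]-part. *)
Lemma set_add_modular A B C : lsubspace C -> A `<=` C ->
  (A :+: B) `&` C = A :+: (B `&` C).
Proof.
move=> sC sAC; apply/seteqP; split.
  move=> _ [[a Aa [b Bb <-]] Cab]; apply: mem_add => //; split=> //.
  by rewrite -(addKr a b) addrC; apply: lsubB => //; apply: sAC.
move=> _ [a Aa [b [Bb Cb] <-]]; split; first exact: mem_add.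
by apply: lsubD => //; apply: sAC.
Qed.

End Subspaces.

(** * Relative dimension *)

Section FiniteDimension.
Variables (K : fieldType) (V : lmodType K).
Implicit Types A B C : set V.

Definition lfree B n (e : 'I_n -> V) : Prop :=
  forall c : 'I_n -> K, B (\sum_i c i *: e i) -> forall i, c i = 0.

Definition lspans A B n (e : 'I_n -> V) : Prop :=
  forall x, A x -> exists c : 'I_n -> K, B (x - \sum_i c i *: e i).

(** For subspaces this is the dimension of the image of [A] in [V/B]. Using representatives in [A]
    instead of cosets keeps whole chains of subspaces in one ambient space. *)
Definition has_dim A B n : Prop :=
  exists e : 'I_n -> V, [/\ forall i, A (e i), lfree B e & lspans A B e].

(** The rank is at most [m < n], so the rows are dependent. Both the exchange argument and the
    duality bound for annihilators rest on this. *)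
Lemma wide_left_kernel m n (M : 'I_n -> 'I_m -> K) : (m < n)%N ->
  exists c : 'I_n -> K, (exists i, c i != 0) /\
    forall j, \sum_i c i * M i j = 0.
Proof.
move=> mn; set N := \matrix_(i < n, j < m) M i j.
have /rowV0Pn[u /sub_kermxP uN u0] : kermx N != 0.
  rewrite -mxrank_eq0 mxrank_ker subn_eq0 -ltnNge.
  exact: leq_ltn_trans (rank_leq_col _) mn.
exists (u 0); split; first by have /rV0Pn := u0.
move=> j; move/rowP/(_ j): uN; rewrite !mxE => uN.
by rewrite -[RHS]uN; apply: eq_bigr => i _; rewrite !mxE.
Qed.

(* Steinitz exchange, modulo B *)
Lemma lfree_leq A B m n (e : 'I_m -> V) (f : 'I_n -> V) : lsubspace B ->
  lspans A B e -> (forall i, A (f i)) -> lfree B f -> (n <= m)%N.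
Proof.
move=> sB spe Af frf; rewrite leqNgt; apply/negP => mn.
have [M HM] := choice (fun i => spe _ (Af i)).
have [c [[i ci] Hc]] := wide_left_kernel M mn.
move: ci; rewrite frf ?eqxx//.
(* The coefficients of the [e j] cancel by the choice of [c], which leaves a combination of elements
   of [B]. *)
suff -> : \sum_i c i *: f i = \sum_i c i *: (f i - \sum_j M i j *: e j).
  exact: lsub_comb.
under [RHS]eq_bigr do rewrite scalerBr scaler_sumr.
rewrite sumrB exchange_big/= [X in _ - X]big1 ?subr0// => j _.
under eq_bigr do rewrite scalerA.
by rewrite -scaler_suml Hc scale0r.
Qed.

Lemma has_dim_uniq A B m n : lsubspace B ->
  has_dim A B m -> has_dim A B n -> m = n.
Proof.
move=> sB [e [Ae fe se]] [f [Af ff sf]]; apply/eqP; rewrite eqn_leq.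
by rewrite (lfree_leq sB sf Ae fe) (lfree_leq sB se Af ff).
Qed.

(** The bound yields a free family of maximal length, and such a family spans [A] modulo [B]. *)
Lemma lfree_max A B m : lsubspace A -> lsubspace B ->
  (forall n (f : 'I_n -> V), (forall i, A (f i)) -> lfree B f -> (n <= m)%N) ->
  exists2 n, (n <= m)%N & has_dim A B n.
Proof.
move=> sA sB ub.
pose P n := `[< exists f : 'I_n -> V, (forall i, A (f i)) /\ lfree B f >].
have exP : exists n, P n.
  exists 0%N; apply/asboolP; exists (fun=> 0); split=> [i|c _ []//].
  exact: lsub0.
have ubP n : P n -> (n <= m)%N by move=> /asboolP[f [Af ff]]; exact: ub ff.
have [n /asboolP[f [Af ff]] nmax] := ex_maxnP exP ubP.
exists n; first exact: ub ff.
exists f; split=> // x Ax; apply: contrapT => nx.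
(* A vector [x] outside the span, put in last position, would lengthen the maximal family. *)
suff : P n.+1 by move=> /nmax; rewrite ltnn.
apply/asboolP; exists (fun i => if unlift ord_max i is Some j then f j else x).
have liftE (j : 'I_n) : widen_ord (leqnSn n) j = lift ord_max j.
  by apply: val_inj => /=; rewrite /bump leqNgt ltn_ord.
split=> [i|c]; first by case: unliftP.
rewrite big_ord_recr /= unlift_none.
under eq_bigr do rewrite liftE liftK.
set s := \sum_i _ => Bs.
(* Otherwise dividing by the coefficient of [x] would express [x] through the family modulo [B]. *)
have c0 : c ord_max = 0.
  apply: contrapT => /eqP cn0; apply: nx.
  exists (fun i => - (c ord_max)^-1 * c (lift ord_max i)).
  under eq_bigr do rewrite -scalerA.
  rewrite -scaler_sumr -/s -[X in X - _](scalerK cn0) scaleNr opprK -scalerDr.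
  by apply: lsubZ; rewrite // addrC.
move: Bs; rewrite c0 scale0r addr0 => /ff cl i.
by case: (unliftP ord_max i) => [j|] ->.
Qed.

(** A basis of [A] modulo [B] followed by one of [B] modulo [C]. For freeness, reading a relation
    modulo [B] kills the first block of coefficients, and the second block is then free modulo
    [C]. *)
Lemma has_dimD A B C p q : lsubspace A -> lsubspace B -> lsubspace C ->
  C `<=` B -> B `<=` A -> has_dim A B p -> has_dim B C q -> has_dim A C (p + q).
Proof.
move=> sA sB sC CB BA [e [Ae fe se]] [f [Bf ff sf]].
pose g (i : 'I_(p + q)) := match fintype.split i with inl i => e i | inr i => f i end.
have gE (c : 'I_(p + q) -> K) : \sum_i c i *: g i =
    \sum_i c (lshift q i) *: e i + \sum_i c (rshift p i) *: f i.
  rewrite big_split_ord; congr (_ + _); apply: eq_bigr => i _.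
    by rewrite /g (unsplitK (inl i)).
  by rewrite /g (unsplitK (inr i)).
exists g; split.
- by move=> i; rewrite /g; case: fintype.split => // j; apply: BA.
- move=> c; rewrite gE => Cc.
  have Bf' : B (\sum_i c (rshift p i) *: f i) by exact: lsub_comb.
  have c1 : forall i, c (lshift q i) = 0.
    apply: fe; rewrite -[X in B X](addrK (\sum_i c (rshift p i) *: f i)).
    by apply: lsubB => //; apply: CB.
  move: Cc; rewrite big1 ?add0r => [/ff c2 i|i _]; last by rewrite c1 scale0r.
  by rewrite -(splitK i); case: fintype.split => j /=.
- move=> x Ax; have [c Bc] := se _ Ax; have [d Cd] := sf _ Bc.
  exists (fun i => match fintype.split i with inl i => c i | inr i => d i end).
  rewrite gE opprD addrA.
  under eq_bigr do rewrite (unsplitK (inl _)).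
  by under [X in _ - X]eq_bigr do rewrite (unsplitK (inr _)).
Qed.

(** By exchange, [n] bounds both kinds of free families: freeness modulo [B] implies freeness modulo
    [C], and vectors of [B] are vectors of [A]. *)
Lemma has_dim_split A B C n : lsubspace A -> lsubspace B -> lsubspace C ->
  C `<=` B -> B `<=` A -> has_dim A C n ->
  exists p q, has_dim A B p /\ has_dim B C q.
Proof.
move=> sA sB sC CB BA [e [Ae fe se]].
have [p _ Hp] : exists2 p, (p <= n)%N & has_dim A B p.
  apply: lfree_max => // k f Af ff; apply: (lfree_leq sC se Af) => c /CB.
  exact: ff.
have [q _ Hq] : exists2 q, (q <= n)%N & has_dim B C q.
  by apply: lfree_max => // k f Bf; apply: (lfree_leq sC se) => i; apply: BA.
by exists p, q.
Qed.

Lemma has_dim0_sub A B : has_dim A B 0 -> A `<=` B.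
Proof. by move=> [e [_ _ se]] x /se[c]; rewrite big_ord0 subr0. Qed.

End FiniteDimension.

(* A linear relation r inducing an isomorphism A/B ~ A'/B'. *)
Lemma has_dim_rel (K : fieldType) (V V' : lmodType K) (r : V -> V' -> Prop)
    (A B : set V) (A' B' : set V') n :
  lsubspace A -> lsubspace A' ->
  r 0 0 ->
  (forall a x x' y y', r x y -> r x' y' -> r (a *: x + x') (a *: y + y')) ->
  (forall x, A x -> exists2 y, A' y & r x y) ->
  (forall y, A' y -> exists2 x, A x & r x y) ->
  (forall x y, A x -> A' y -> r x y -> B x <-> B' y) ->
  has_dim A B n -> has_dim A' B' n.
Proof.
move=> sA sA' r0 rP AA' A'A BB' [e [Ae fe se]].
have /choice[f Hf] (i : 'I_n) : exists y, A' y /\ r (e i) y.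
  by have [y] := AA' _ (Ae i); exists y.
have [f1 f2] : (forall i, A' (f i)) /\ (forall i, r (e i) (f i)).
  by split=> i; have [] := Hf i.
have rs (c : 'I_n -> K) : r (\sum_i c i *: e i) (\sum_i c i *: f i).
  by elim/big_rec2: _ => // i x y _ rxy; apply: rP.
have Ac (c : 'I_n -> K) : A (\sum_i c i *: e i) by apply: lsub_comb.
have A'c (c : 'I_n -> K) : A' (\sum_i c i *: f i) by apply: lsub_comb.
exists f; split=> // [c B'c|y A'y].
  by apply: fe; apply/(BB' _ (\sum_i c i *: f i)).
have [x Ax rxy] := A'A _ A'y; have [c Bc] := se _ Ax; exists c.
apply: (BB' _ _ _ _ _).1 Bc; [exact: lsubB|exact: lsubB|].
have := rP (-1) _ _ _ _ (rs c) rxy; rewrite !scaleN1r.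
by rewrite ![- _ + _]addrC.
Qed.

(** * Relative dimension with values in the extended reals *)

Section Dimq.
Variable R : realType.

(** As for [vdim], the infimum of the empty set gives +oo. The parameter [B] covers [vdim] and
    [qdim] at once, without quotient types. *)
Definition dimq (V : lmodType R[i]) (A B : set V) : \bar R :=
  ereal_inf [set n%:R%:E | n in has_dim A B].

Lemma dimqE (V : lmodType R[i]) (A B : set V) n :
  lsubspace B -> has_dim A B n -> dimq A B = n%:R%:E.
Proof.
move=> sB ABn; rewrite /dimq (_ : has_dim A B = [set n]).
  by rewrite image_set1 ereal_inf1.
by apply/seteqP; split=> [m /= Hm|_ ->//]; apply: has_dim_uniq Hm ABn.
Qed.

Lemma dimq_infty (V : lmodType R[i]) (A B : set V) :
  ~ (exists n, has_dim A B n) -> dimq A B = +oo%E.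
Proof.
move=> nAB; rewrite /dimq (_ : has_dim A B = set0) ?image_set0 ?ereal_inf0//.
by apply/seteqP; split=> // m Hm; apply: nAB; exists m.
Qed.

Lemma dimq_fin (V : lmodType R[i]) (A B : set V) : lsubspace B ->
  (dimq A B < +oo)%E -> exists n, has_dim A B n.
Proof.
by move=> sB; apply: contraPP => nAB; rewrite dimq_infty// ltxx.
Qed.

Lemma dimq_rel (V V' : lmodType R[i]) (r : V -> V' -> Prop)
    (A B : set V) (A' B' : set V') :
  lsubspace A -> lsubspace A' -> r 0 0 ->
  (forall a x x' y y', r x y -> r x' y' -> r (a *: x + x') (a *: y + y')) ->
  (forall x, A x -> exists2 y, A' y & r x y) ->
  (forall y, A' y -> exists2 x, A x & r x y) ->
  (forall x y, A x -> A' y -> r x y -> B x <-> B' y) ->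
  dimq A B = dimq A' B'.
Proof.
move=> sA sA' r0 rP AA' A'A BB'; rewrite /dimq; congr ereal_inf.
congr image; apply/seteqP; split=> n; first exact: has_dim_rel rP AA' A'A BB'.
apply: (has_dim_rel (r := fun x y => r y x)) => //.
  by move=> a x x' y y'; apply: rP.
by move=> x y A'x Ay ryx; have [] := BB' _ _ Ay A'x ryx.
Qed.

Lemma vdimE (V : lmodType R[i]) (A : set V) : vdim A = dimq A [set 0].
Proof.
rewrite /vdim /dimq; congr ereal_inf; congr image; apply/seteqP; split=> n.
  move=> [e [Ae fe se]]; exists e; split=> // x /se[c ->]; exists c.
  by rewrite /= subrr.
move=> [e [Ae fe se]]; exists e; split=> // x /se[c /= Hc]; exists c.
exact/subr0_eq.
Qed.

Section OneSpace.
Variable V : lmodType R[i].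
Implicit Types A B C : set V.

Lemma dimq_ge0 A B : (0 <= dimq A B)%E.
Proof. by apply: le_ereal_inf_tmp => _ [n _ <-]; rewrite lee_fin. Qed.

Lemma pivE B x y : lsubspace B -> (piv B x = piv B y) <-> B (x - y).
Proof.
move=> sB; rewrite pivP lspan_id//; split=> [/set_mem//|Bxy].
exact/mem_set.
Qed.

Lemma lsubspace_piv A B : lsubspace A -> lsubspace (piv B @` A).
Proof.
move=> sA; apply: lsubspaceP; first by exists 0; [exact: lsub0|rewrite linear0].
move=> a _ _ [x Ax <-] [y Ay <-]; exists (a *: x + y); first exact: lsubP.
by rewrite linearP.
Qed.

Lemma dimq_piv A B : lsubspace A -> lsubspace B ->
  vdim (piv B @` A) = dimq A B.
Proof.
move=> sA sB; rewrite vdimE; apply/esym.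
apply: (dimq_rel (r := fun x p => p = piv B x)) => //.
- exact: lsubspace_piv.
- by rewrite linear0.
- by move=> a x x' y y' -> ->; rewrite linearP.
- by move=> x Ax; exists (piv B x) => //; exists x.
- by move=> _ [x Ax <-]; exists x.
- move=> x p Ax _ ->; rewrite /= -[0](linear0 (piv B)) pivE// subr0.
  by [].
Qed.

Lemma qdimE A B : lsubspace A -> lsubspace B -> qdim A B = dimq A B.
Proof. exact: dimq_piv. Qed.

(** In the finite case bases split and concatenate. If [A/C] is infinite-dimensional, then so is
    [A/B] or [B/C], since otherwise their bases would concatenate. *)
Lemma dimqD A B C : lsubspace A -> lsubspace B -> lsubspace C ->
  C `<=` B -> B `<=` A -> dimq A C = (dimq A B + dimq B C)%E.
Proof.
move=> sA sB sC CB BA.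
have [[n ACn]|nAC] := pselect (exists n, has_dim A C n).
  have [p [q [ABp BCq]]] := has_dim_split sA sB sC CB BA ACn.
  rewrite (dimqE sB ABp) (dimqE sC BCq).
  by rewrite (dimqE sC (has_dimD sA sB sC CB BA ABp BCq)) natrD.
rewrite (dimq_infty nAC); apply/esym.
have [[p ABp]|nAB] := pselect (exists n, has_dim A B n); last first.
  rewrite (dimq_infty nAB) addye// -ltNye.
  by rewrite (lt_le_trans _ (dimq_ge0 _ _)).
have [[q BCq]|nBC] := pselect (exists n, has_dim B C n).
  by case: nAC; exists (p + q)%N; apply: has_dimD BCq.
rewrite (dimq_infty nBC) addey// -ltNye.
by rewrite (lt_le_trans _ (dimq_ge0 _ _)).
Qed.

Lemma dimq_leq A B C : lsubspace A -> lsubspace B -> lsubspace C ->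
  C `<=` B -> B `<=` A -> (dimq B C <= dimq A C)%E.
Proof.
by move=> sA sB sC CB BA; rewrite (dimqD sA sB sC)// leeDr// dimq_ge0.
Qed.

Lemma dimq_leql A B C : lsubspace A -> lsubspace B -> lsubspace C ->
  C `<=` B -> B `<=` A -> (dimq A B <= dimq A C)%E.
Proof.
by move=> sA sB sC CB BA; rewrite (dimqD sA sB sC)// leeDl// dimq_ge0.
Qed.

(** The second isomorphism theorem, realised by the relation of congruence modulo [B]. *)
Lemma dimq_addI A B : lsubspace A -> lsubspace B ->
  dimq (A :+: B) B = dimq A (A `&` B).
Proof.
move=> sA sB; apply/esym; apply: (dimq_rel (r := fun x y => B (x - y))) => //.
- exact: lsubspace_add.
- by rewrite subrr; apply: lsub0.
- move=> a x x' y y' Bxy Bxy'; rewrite opprD addrACA -scalerBr.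
  exact: lsubP.
- move=> x Ax; exists x; first exact: sub_addl.
  by rewrite subrr; apply: lsub0.
- move=> _ [x Ax [b Bb <-]]; exists x => //.
  by rewrite opprD addrA subrr sub0r; apply: lsubN.
- move=> x y Ax _ Bxy; split=> [[_ Bx]|By].
    by rewrite -(subKr x y); apply: lsubB.
  by split=> //; rewrite -(subrK y x); apply: lsubD.
Qed.

(** Additivity leaves dimension 0 for [A/B]; finiteness of [A/C] permits the cancellation. *)
Lemma dimq_eq A B C : lsubspace A -> lsubspace B -> lsubspace C ->
  C `<=` B -> B `<=` A -> (dimq A C < +oo)%E -> (dimq A C <= dimq B C)%E ->
  A = B.
Proof.
move=> sA sB sC CB BA /(dimq_fin sC)[n ACn].
have [p [q [ABp BCq]]] := has_dim_split sA sB sC CB BA ACn.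
rewrite (dimqD sA sB sC CB BA) (dimqE sB ABp) (dimqE sC BCq) lee_fin -natrD.
rewrite ler_nat -{2}[q]add0n leq_add2r leqn0 => /eqP p0.
by apply/seteqP; split=> //; apply: has_dim0_sub; rewrite -p0.
Qed.

Lemma dimq_eql A B C : lsubspace A -> lsubspace B -> lsubspace C ->
  C `<=` B -> B `<=` A -> (dimq A C < +oo)%E -> (dimq A C <= dimq A B)%E ->
  B = C.
Proof.
move=> sA sB sC CB BA /(dimq_fin sC)[n ACn].
have [p [q [ABp BCq]]] := has_dim_split sA sB sC CB BA ACn.
rewrite (dimqD sA sB sC CB BA) (dimqE sB ABp) (dimqE sC BCq) lee_fin -natrD.
rewrite ler_nat -{2}[p]addn0 leq_add2l leqn0 => /eqP q0.
by apply/seteqP; split=> //; apply: has_dim0_sub; rewrite -q0.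
Qed.

(* The two sides refine to the same five dimensions; the main point is
   (U + Y) & (V + Y) / (U & V + Y) ~ (U + V) & Y / (U & Y + V & Y). *)
Lemma dimq_pair_index U A Y : lsubspace U -> lsubspace A -> lsubspace Y ->
  (dimq (U `&` A) [set 0%R] + dimq Y ((U `&` Y) :+: (A `&` Y)) +
     dimq [set: V] (U :+: A :+: Y) =
   dimq (U `&` A `&` Y) [set 0%R] + dimq ((U :+: Y) `&` (A :+: Y)) Y +
     dimq [set: V] (U :+: A))%E.
Proof.
move=> sU sA sY.
set S := _ :+: (A `&` Y); set D := (U :+: Y) `&` _.
pose T := (U :+: A) `&` Y; pose P := (U `&` A) :+: Y.
have sT0 := lsubspaceT V; have s0 := lsubspace0 V.
have sUA : lsubspace (U `&` A) by exact: lsubspaceI.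
have sUpA : lsubspace (U :+: A) by exact: lsubspace_add.
have sUpY : lsubspace (U :+: Y) by exact: lsubspace_add.
have sApY : lsubspace (A :+: Y) by exact: lsubspace_add.
have sUY : lsubspace (U `&` Y) by exact: lsubspaceI.
have sAY : lsubspace (A `&` Y) by exact: lsubspaceI.
have sUAY : lsubspace (U `&` A `&` Y) by exact: lsubspaceI.
have sUpAY : lsubspace (U :+: A :+: Y) by exact: lsubspace_add.
have sS : lsubspace S by exact: lsubspace_add.
have sD : lsubspace D by exact: lsubspaceI.
have sT : lsubspace T by exact: lsubspaceI.
have sP : lsubspace P by exact: lsubspace_add.
have ST : S `<=` T.
  move=> _ [u [Uu Yu] [a [Aa Ya] <-]]; split; first exact: mem_add.
  exact: lsubD.
have PD : P `<=` D.
  by move=> _ [x [Ux Ax] [y Yy <-]]; split; apply: mem_add.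
have -> : dimq (U `&` A) [set 0%R] =
    (dimq P Y + dimq (U `&` A `&` Y) [set 0%R])%E.
  rewrite (dimqD sUA sUAY)//; first by rewrite dimq_addI.
  by move=> x ->; apply: lsub0.
have -> : dimq Y S = (dimq Y T + dimq T S)%E by apply: dimqD => // x [].
have -> : dimq [set: V] (U :+: A) =
    (dimq [set: V] (U :+: A :+: Y) + dimq Y T)%E.
  rewrite (dimqD sT0 sUpAY)//; last exact: sub_addl.
  by rewrite [_ :+: Y]set_addC dimq_addI// /T [Y `&` _]setIC.
have -> : dimq D Y = (dimq D P + dimq P Y)%E by apply: dimqD => //; apply: sub_addr.
suff -> : dimq D P = dimq T S.
  have := (dimq_ge0 P Y, dimq_ge0 (U `&` A `&` Y) [set 0%R], dimq_ge0 Y T,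
    dimq_ge0 T S, dimq_ge0 [set: V] (U :+: A :+: Y)).
  move=> [[[[]]]].
  set a := dimq _ _; set b := dimq _ _; set c := dimq _ _; set d := dimq _ _.
  set e := dimq _ _ => a0 b0 c0 d0 e0.
  rewrite [(a + b)%E]addeC [(c + d)%E]addeC [(d + a)%E]addeC.
  by rewrite [(e + c)%E]addeC !addeA.
(* An element [z = u + y = v + y'] of [D] corresponds to [t = u - v = y' - y], which lies in both
   [U :+: A] and [Y]. *)
apply: (dimq_rel (r := fun z t =>
  exists u v, [/\ U u, A v, Y (z - u) & t = u - v])) => //.
- by exists 0, 0; split; rewrite ?subrr//; apply: lsub0.
- move=> a x x' y y' [u [v [Uu Av Yu ->]]] [u' [v' [Uu' Av' Yu' ->]]].
  exists (a *: u + u'), (a *: v + v'); split; [exact: lsubP|exact: lsubP| |].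
    by rewrite opprD addrACA -scalerBr; apply: lsubP.
  by rewrite opprD addrACA -scalerBr.
- move=> z [[u Uu [y Yy zu]] [v Av [y' Yy' zv]]]; exists (u - v).
    split; first by apply: mem_add => //; apply: lsubN.
    have -> : u - v = y' - y.
      by apply/eqP; rewrite subr_eq addrAC eq_sym subr_eq addrC zv zu.
    exact: lsubB.
  by exists u, v; split=> //; rewrite -zu addrAC subrr add0r.
- move=> t [[u Uu [v Av <-]] Yt]; exists u.
    split; first exact: sub_addl.
    by rewrite -(addrK v u) addrC; apply: mem_add => //; apply: lsubN.
  exists u, (- v); rewrite opprK subrr; split=> //; first exact: lsubN.
  exact: lsub0.
- move=> z t Dz Tt [u [v [Uu Av Yzu tuv]]]; split.
    (* If [z = p + y] with [p] in both [U] and [A], then [t = (u - p) + (p - v)], and both summands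
       lie in [Y]. *)
    move=> [p [Up Ap] [y Yy pyz]]; rewrite tuv -(subrK p u) -addrA.
    have Yup : Y (u - p).
      have -> : u - p = y - (z - u).
        by rewrite -pyz opprB addrCA [p + y]addrC opprD [y + _]addrA subrr add0r.
      exact: lsubB.
    apply: mem_add; first by split=> //; apply: lsubB.
    split; first exact: lsubB.
    have -> : p - v = t - (u - p) by rewrite tuv opprB [RHS]addrC addrA subrK.
    by apply: lsubB => //; case: Tt.
  (* Conversely, [t = a + b] makes [u - a = v + b] a common element of [U] and [A] that differs from
     [z] by an element of [Y]. *)
  move=> [a [Ua Ya] [b [Ab Yb] abt]].
  have uab : u - a = v + b.
    by apply/eqP; rewrite subr_eq -addrA [b + a]addrC abt tuv addrC subrK.
  rewrite -(subrK (u - a) z) addrC; apply: mem_add.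
    by split; [exact: lsubB|rewrite uab; exact: lsubD].
  by rewrite opprB addrA addrAC; apply: lsubD.
Qed.

End OneSpace.
End Dimq.

(** * Annihilators *)

Section Annihilators.
Variables (R : realType) (Z : lmodType R[i]) (w : {skew_hermitian Z}).
Implicit Types A B C L : set Z.
Local Notation "A ^w" := (ann w A) (at level 2, format "A ^w").

Lemma orthC x y : w x y = 0 -> w y x = 0.
Proof. by move=> wxy; rewrite hermC wxy rmorph0 mulr0. Qed.

Lemma annS A B : A `<=` B -> B^w `<=` A^w.
Proof. by move=> AB x Bx y /AB; apply: Bx. Qed.

Lemma sub_ann2 A : A `<=` A^w^w.
Proof. by move=> x Ax y /(_ _ Ax); apply: orthC. Qed.

Lemma ann3 A : A^w^w^w = A^w.
Proof. by apply/seteqP; split; [apply/annS/sub_ann2|apply: sub_ann2]. Qed.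

Lemma ann_closed_ann A : ann_closed w A^w.
Proof. exact: ann3. Qed.

Lemma ann_add A B : lsubspace A -> lsubspace B -> (A :+: B)^w = A^w `&` B^w.
Proof.
move=> sA sB; apply/seteqP; split=> x.
  by move=> Hx; split; apply: annS Hx; [apply: sub_addl|apply: sub_addr].
by move=> [Ax Bx] _ [a Aa [b Bb <-]]; rewrite linearDr /= Ax// Bx// addr0.
Qed.

Lemma ann_closedI A B : ann_closed w A -> ann_closed w B -> ann_closed w (A `&` B).
Proof.
move=> cA cB; apply/seteqP; split; last exact: sub_ann2.
by move=> x Hx; split; [rewrite -cA|rewrite -cB]; apply: annS Hx => y;
   apply: annS => z [].
Qed.

Lemma ann_set0 : [set 0]^w = [set: Z].
Proof. by apply/seteqP; split=> // x _ _ ->; rewrite linear0r. Qed.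

(** A family in [A^w] longer than a basis of [B/A] has a nontrivial combination orthogonal to that
    basis. It is also orthogonal to [A], hence lies in [B^w], so the family is not free modulo
    [B^w]. *)
Lemma has_dim_ann A B n : lsubspace A -> lsubspace B -> A `<=` B ->
  has_dim B A n -> exists2 m, (m <= n)%N & has_dim A^w B^w m.
Proof.
move=> sA sB AB [e [Be _ se]].
apply: lfree_max; [exact: lsubspace_ann|exact: lsubspace_ann|] => m f Af ff.
rewrite leqNgt; apply/negP => nm.
have [c [[i ci] Hc]] := wide_left_kernel (fun i j => w (f i) (e j)) nm.
move: ci; rewrite ff ?eqxx// => y By.
have [d Ad] := se _ By.
have fA : A^w (\sum_i c i *: f i) by apply: lsub_comb => //; apply: lsubspace_ann.
rewrite -(subrK (\sum_i d i *: e i) y) linearDr /= fA// add0r linear_sumr /=.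
rewrite big1// => j _; rewrite linearZr_LR /= linear_sumlz /=.
under eq_bigr do rewrite linearZl_LR /=.
by rewrite Hc mulr0.
Qed.

Lemma dimq_ann_le A B : lsubspace A -> lsubspace B -> A `<=` B ->
  (dimq A^w B^w <= dimq B A)%E.
Proof.
move=> sA sB AB.
have [[n BAn]|nBA] := pselect (exists n, has_dim B A n); last first.
  by rewrite (dimq_infty nBA) leey.
have [m mn Hm] := has_dim_ann sA sB AB BAn.
rewrite (dimqE sA BAn) (dimqE _ Hm); last exact: lsubspace_ann.
by rewrite lee_fin ler_nat.
Qed.

(** Duality applied twice gives dim [B^w^w/A] <= dim [A^w/B^w] <= dim [B/A]. As [B] lies in [B^w^w]
    and dim [B/A] is finite, equality holds throughout. *)
Lemma ann_closed_ext A B : lsubspace A -> lsubspace B -> A `<=` B ->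
  ann_closed w A -> (dimq B A < +oo)%E ->
  ann_closed w B /\ dimq A^w B^w = dimq B A.
Proof.
move=> sA sB AB cA fin.
have le1 := dimq_ann_le sA sB AB.
have le2 := dimq_ann_le (lsubspace_ann w B) (lsubspace_ann w A) (annS AB).
rewrite cA in le2.
have le3 := le_trans le2 le1.
have cB : B^w^w = B.
  apply: (dimq_eq (C := A)) => //; first exact: lsubspace_ann.
  - exact: sub_ann2.
  - exact: le_lt_trans fin.
split=> //; apply/le_anti/andP; split=> //.
by rewrite cB in le2.
Qed.

Hypothesis w_nd : symplectic w.

Lemma ann_setT : [set: Z]^w = [set 0].
Proof.
apply/seteqP; split=> [x Hx|_ -> y _]; last by rewrite linear0l.
by apply: w_nd => y; apply: Hx.
Qed.

Lemma dimq_annT_le A : lsubspace A -> (dimq A^w [set 0%R] <= dimq [set: Z] A)%E.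
Proof.
by move=> sA; rewrite -ann_setT; apply: dimq_ann_le => //; apply: lsubspaceT.
Qed.

(** A finite extension of the zero subspace, which is w-closed by non-degeneracy. *)
Lemma ann_closed_findim A : lsubspace A -> (dimq A [set 0%R] < +oo)%E ->
  ann_closed w A /\ dimq [set: Z] A^w = dimq A [set 0].
Proof.
move=> sA fin; rewrite -ann_set0; apply: ann_closed_ext => //.
- exact: lsubspace0.
- by move=> x ->; apply: lsub0.
- by rewrite /ann_closed ann_set0 ann_setT.
Qed.

(** Since [A^w] is finite-dimensional, the codimension of [A^w^w] is dim [A^w], hence at least that
    of the smaller space [A]. *)
Lemma ann_closed_codim A : lsubspace A -> (dimq [set: Z] A < +oo)%E ->
  (dimq [set: Z] A <= dimq A^w [set 0%R])%E -> ann_closed w A.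
Proof.
move=> sA fin le.
have sAw := lsubspace_ann w A.
have [_ E] := ann_closed_findim sAw (le_lt_trans (dimq_annT_le sA) fin).
apply: (dimq_eql (A := [set: Z])) => //; last by rewrite E.
- exact: lsubspaceT.
- exact: lsubspace_ann.
- exact: sub_ann2.
Qed.

End Annihilators.

(** * Fredholm pairs *)

Section FredholmPairs.
Variables (R : realType) (Z : lmodType R[i]).
Implicit Types A B U V Y : set Z.

Lemma fredholm_pairE U V : lsubspace U -> lsubspace V ->
  fredholm_pair U V /\ fredholm_index U V = 0%E <->
  exists n, has_dim (U `&` V) [set 0] n /\ has_dim [set: Z] (U :+: V) n.
Proof.
move=> sU sV; have sT := lsubspaceT Z; have s0 := lsubspace0 Z.
have sUV := lsubspace_add sU sV.
rewrite /fredholm_pair /fredholm_index vdimE qdimE//; split.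
  move=> [[/(dimq_fin s0)[n Hn] /(dimq_fin sUV)[m Hm]]].
  rewrite (dimqE s0 Hn) (dimqE sUV Hm) => /eqP.
  rewrite -EFinB eqe subr_eq0 eqr_nat => /eqP nm.
  by exists n; split=> //; rewrite nm.
by move=> [n [/(dimqE s0)-> /(dimqE sUV)->]]; rewrite !ltry subee.
Qed.

(** The quotient of [U & V] by its trace on [Y] embeds into the space of elements common to
    [U :+: Y] and [V :+: Y], taken modulo [Y]. *)
Lemma dimq_setI_le U V Y : lsubspace U -> lsubspace V -> lsubspace Y ->
  (dimq (U `&` V) [set 0%R] <=
   dimq ((U :+: Y) `&` (V :+: Y)) Y + dimq (U `&` V `&` Y) [set 0%R])%E.
Proof.
move=> sU sV sY.
have sUV := lsubspaceI sU sV; have sUVY := lsubspaceI sUV sY.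
rewrite (dimqD sUV sUVY (lsubspace0 Z)) => [|x ->|x []//]; last exact: lsub0.
apply: leeD => //; rewrite -dimq_addI//; apply: dimq_leq => //.
- by apply: lsubspaceI; apply: lsubspace_add.
- exact: lsubspace_add.
- exact: sub_addr.
- by move=> _ [x [Ux Vx] [y Yy <-]]; split; apply: mem_add.
Qed.

(* In the index formula, all terms but those defining the index of (U, V) only
   depend on the traces of U and V on Y and on their sums with Y. *)
Lemma fredholm_pair_index0 U V Y :
  lsubspace U -> lsubspace V -> lsubspace Y ->
  dimq Y ((U `&` Y) :+: (V `&` Y)) = dimq ((U :+: Y) `&` (V :+: Y)) Y ->
  dimq [set: Z] (U :+: V :+: Y) = dimq (U `&` V `&` Y) [set 0] ->
  (dimq ((U :+: Y) `&` (V :+: Y)) Y < +oo)%E ->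
  (dimq (U `&` V `&` Y) [set 0%R] < +oo)%E ->
  fredholm_pair U V /\ fredholm_index U V = 0%E.
Proof.
move=> sU sV sY eY eZ finD finK; apply/fredholm_pairE => //.
have s0 := lsubspace0 Z.
have [d Hd] := dimq_fin sY finD; have [k Hk] := dimq_fin s0 finK.
have [n Hn] : exists n, has_dim (U `&` V) [set 0] n.
  apply: dimq_fin => //; apply: le_lt_trans (dimq_setI_le sU sV sY) _.
  by rewrite (dimqE sY Hd) (dimqE s0 Hk) -EFinD ltry.
have := dimq_pair_index sU sV sY.
rewrite eY eZ (dimqE sY Hd) (dimqE s0 Hk) (dimqE s0 Hn).
rewrite -!EFinD -!natrD.
(* An infinite codimension of [U :+: V] would make one side of the index formula infinite and leave
   the other finite. *)
have [[m Hm]|nm] := pselect (exists n, has_dim [set: Z] (U :+: V) n); last first.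
  by rewrite (dimq_infty nm) addey.
rewrite (dimqE _ Hm); last exact: lsubspace_add.
rewrite -EFinD -natrD => /eqP; rewrite eqe eqr_nat => /eqP E.
by exists n; split=> //; rewrite (_ : n = m) //; lia.
Qed.

Lemma lagrangian_closed (w : {skew_hermitian Z}) Y :
  lagrangian w Y -> ann_closed w Y.
Proof. by case=> _ YE; rewrite /ann_closed -!YE. Qed.

End FredholmPairs.

(** * The equality case of the index formula *)

Section Core.
Variables (R : realType) (Z : lmodType R[i]) (w : {skew_hermitian Z}).
Variables (Y alpha beta : set Z).
Hypotheses (w_nd : symplectic w) (lY : lagrangian w Y).
Hypotheses (lalpha : lagrangian w alpha) (lbeta : lagrangian w beta).
Hypothesis ab_fredholm :
  fredholm_pair alpha beta /\ fredholm_index alpha beta = 0%E.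
Local Notation W1 := (alpha `&` Y).
Local Notation W2 := (beta `&` Y).
Hypothesis fin_cod : (dimq Y (W1 :+: W2) < +oo)%E.

(* The index formula gives s + t = k + d with s = dim Y/(W1 + W2),
   t = codim (alpha + beta + Y), k = dim (W1 & W2) and
   d = dim ((alpha + Y) & (beta + Y))/Y, while duality gives k <= t and
   d <= dim (W1 + W2)^w/Y <= s; hence all these inequalities are equalities. *)
Lemma fredholm_equalities :
  [/\ (alpha :+: Y) `&` (beta :+: Y) = ann w (W1 :+: W2),
      ann_closed w (W1 :+: W2),
      ann_closed w (alpha :+: beta :+: Y),
      dimq (ann w (W1 :+: W2)) Y = dimq Y (W1 :+: W2) &
      dimq [set: Z] (alpha :+: beta :+: Y) = dimq (W1 `&` W2) [set 0] /\
      (dimq (W1 `&` W2) [set 0%R] < +oo)%E].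
Proof.
have [sY Yann] := lY; have [sa aann] := lalpha; have [sb bann] := lbeta.
have s0 := lsubspace0 Z; have sT := lsubspaceT Z.
have sW1 : lsubspace W1 by exact: lsubspaceI.
have sW2 : lsubspace W2 by exact: lsubspaceI.
have sS := lsubspace_add sW1 sW2.
have sab := lsubspace_add sa sb; have sabY := lsubspace_add sab sY.
have saY := lsubspace_add sa sY; have sbY := lsubspace_add sb sY.
have sK := lsubspaceI sW1 sW2.
have sD := lsubspaceI saY sbY.
have sSw := lsubspace_ann w (W1 :+: W2).
have KE : alpha `&` beta `&` Y = W1 `&` W2.
  by rewrite setIACA setIid.
have KannE : ann w (alpha :+: beta :+: Y) = W1 `&` W2.
  by rewrite !ann_add// -aann -bann -Yann KE.
have aYann : ann w (alpha :+: Y) = W1 by rewrite ann_add// -aann -Yann.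
have bYann : ann w (beta :+: Y) = W2 by rewrite ann_add// -bann -Yann.
have SY : W1 :+: W2 `<=` Y by apply: add_subset => // x [].
have YS : Y `<=` ann w (W1 :+: W2) by have := annS (w := w) SY; rewrite -Yann.
have YD : Y `<=` (alpha :+: Y) `&` (beta :+: Y).
  by move=> y Yy; split; apply: sub_addr.
have DS : (alpha :+: Y) `&` (beta :+: Y) `<=` ann w (W1 :+: W2).
  rewrite ann_add// -aYann -bYann => x [ax bx].
  by split; apply: sub_ann2.
have [n [Hab HabZ]] := (fredholm_pairE sa sb).1 ab_fredholm.
have KS : W1 `&` W2 `<=` alpha `&` beta by move=> x [[? _] [? _]].
have finK : (dimq (W1 `&` W2) [set 0%R] < +oo)%E.
  apply: le_lt_trans (dimq_leq _ sK s0 _ KS) _; [exact: lsubspaceI| |].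
    by move=> x ->; apply: lsub0.
  by rewrite (dimqE s0 Hab) ltry.
have leS : (dimq (ann w (W1 :+: W2)) Y <= dimq Y (W1 :+: W2))%E.
  by have := dimq_ann_le w sS sY SY; rewrite -Yann.
have leD : (dimq ((alpha :+: Y) `&` (beta :+: Y)) Y <=
            dimq (ann w (W1 :+: W2)) Y)%E by exact: dimq_leq.
have finS := le_lt_trans leS fin_cod.
have leK : (dimq (W1 `&` W2) [set 0%R] <=
            dimq [set: Z] (alpha :+: beta :+: Y))%E.
  by rewrite -KannE; apply: dimq_annT_le.
have := dimq_pair_index sa sb sY.
have [s Hs] := dimq_fin sS fin_cod; have [k Hk] := dimq_fin s0 finK.
have [a Ha] := dimq_fin sY finS.
have [d Hd] := dimq_fin sY (le_lt_trans leD finS).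
rewrite KE (dimqE sY Hd) (dimqE sS Hs) (dimqE s0 Hk) (dimqE s0 Hab).
rewrite (dimqE sab HabZ).
have [[t Ht]|nt] := pselect (exists n, has_dim [set: Z] (alpha :+: beta :+: Y) n);
    last by rewrite -!EFinD (dimq_infty nt) addey.
rewrite (dimqE sabY Ht) -!EFinD -!natrD => /eqP; rewrite eqe eqr_nat => /eqP E.
move: leS leD leK; rewrite (dimqE sS Hs) (dimqE sY Ha) (dimqE sY Hd).
rewrite (dimqE s0 Hk) (dimqE sabY Ht) !lee_fin !ler_nat => sa' da kt.
have [das kt'] : (d = a /\ a = s) /\ k = t by lia.
have [da' as'] := das.
split.
- apply/esym/(dimq_eq (C := Y)) => //.
  by rewrite (dimqE sY Hd) (dimqE sY Ha) da'.
(* Write [S] for [W1 :+: W2]. Then dim [Y/S^w^w] = dim [S^w/Y] = dim [Y/S], while [S^w^w] lies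
   between [S] and [Y]. *)
- have [_ E2] := ann_closed_ext sY sSw YS (lagrangian_closed lY) finS.
  apply: (dimq_eql (A := Y)) => //.
  + exact: lsubspace_ann.
  + exact: sub_ann2.
  + by have := annS (w := w) YS; rewrite -Yann.
  + by move: E2; rewrite -Yann => ->; rewrite (dimqE sS Hs) (dimqE sY Ha) as'.
- apply: ann_closed_codim => //; first by rewrite (dimqE sabY Ht) ltry.
  by rewrite KannE (dimqE sabY Ht) (dimqE s0 Hk) kt'.
- by rewrite as'.
- by rewrite kt' ltry.
Qed.

(** The sum of [alpha :+: Y] and [beta :+: Y] is w-closed with annihilator [W1 & W2], so it contains
    [W1^w]. Write [x] in [W1^w] as [a + b] accordingly: [b] lies in both [W1^w] and [W2^w], hence in
    [alpha :+: Y], and so does [x]. The second equality is symmetric. *)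
Lemma ann_traces : alpha :+: Y = ann w W1 /\ beta :+: Y = ann w W2.
Proof.
have [sY Yann] := lY; have [sa aann] := lalpha; have [sb bann] := lbeta.
have sW1 : lsubspace W1 by exact: lsubspaceI.
have sW2 : lsubspace W2 by exact: lsubspaceI.
have saY := lsubspace_add sa sY; have sbY := lsubspace_add sb sY.
have [DE _ cL _ _] := fredholm_equalities.
have LE := set_add3 sa sb sY.
have KannE : ann w (alpha :+: beta :+: Y) = W1 `&` W2.
  rewrite !ann_add//; last exact: lsubspace_add.
  by rewrite -aann -bann -Yann setIACA setIid.
have sub1 : alpha :+: Y `<=` ann w W1.
  have <- : ann w (alpha :+: Y) = W1 by rewrite ann_add// -aann -Yann.
  exact: sub_ann2.
have sub2 : beta :+: Y `<=` ann w W2.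
  have <- : ann w (beta :+: Y) = W2 by rewrite ann_add// -bann -Yann.
  exact: sub_ann2.
have N1 : ann w W1 `<=` (alpha :+: Y) :+: (beta :+: Y).
  by rewrite LE -cL KannE; apply: (annS (w := w)) => x [].
have N2 : ann w W2 `<=` (alpha :+: Y) :+: (beta :+: Y).
  by rewrite LE -cL KannE; apply: (annS (w := w)) => x [].
rewrite ann_add// in DE.
split; apply/seteqP; split=> // x Hx.
  have [a La [b Lb E]] := N1 _ Hx.
  have Nb : ann w W1 b.
    rewrite (_ : b = x - a); last by rewrite -E addrC addKr.
    exact: (lsubB (lsubspace_ann w W1) Hx (sub1 _ La)).
  have : (ann w W1 `&` ann w W2) b by split=> //; apply: sub2.
  by rewrite -DE -E => -[Lb' _]; apply: lsubD.
have [a La [b Lb E]] := N2 _ Hx.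
have Na : ann w W2 a.
  rewrite (_ : a = x - b); last by rewrite -E addrK.
  exact: (lsubB (lsubspace_ann w W2) Hx (sub2 _ Lb)).
have : (ann w W1 `&` ann w W2) a by split=> //; apply: sub1.
by rewrite -DE -E => -[_ La']; apply: lsubD.
Qed.

End Core.

(** * Lagrangian splittings *)

Section DirectSum.
Variables (K : nzRingType) (Z : lmodType K) (X Y : set Z).
Hypotheses (sX : lsubspace X) (sY : lsubspace Y).
Hypothesis XY : direct_sum [set: Z] X Y.
Implicit Types B E L U : set Z.

Lemma direct_sum_add z : exists x y, [/\ X x, Y y & z = x + y].
Proof.
have : [set: Z] z by []; case: XY => <- _ [x Xx [y Yy <-]].
by exists x, y.
Qed.

Lemma direct_sum_cap z : X z -> Y z -> z = 0.
Proof.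
by move=> Xz Yz; have : (X `&` Y) z by []; case: XY => _ -> ->.
Qed.

(** Puts the domain in a form to which the modular law applies. *)
Lemma relation_domE U : relation_dom X Y U = (U :+: Y) `&` X.
Proof.
apply/seteqP; split=> x.
  move=> [Xx [y Yy Uxy]]; split=> //.
  by rewrite -(addrK y x); apply: mem_add => //; apply: lsubN.
move=> [[u Uu [y Yy <-]] Xx]; split=> //; exists (- y); first exact: lsubN.
by rewrite addrK.
Qed.

Lemma setI_add_transversal L : lsubspace L -> Y `<=` L -> (L `&` X) :+: Y = L.
Proof.
move=> sL YL; rewrite set_addC setIC -set_add_modular//.
rewrite set_addC; have [-> _] := XY; by rewrite setTI.
Qed.

Lemma add_cap_left E B : lsubspace E -> E `<=` X -> B `<=` Y ->
  B 0 -> (E :+: B) `&` X = E.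
Proof.
move=> sE EX BY B0; apply/seteqP; split=> [_ [[e Ee [b Bb <-]] Xeb]|e Ee].
  have -> : b = 0.
    apply: direct_sum_cap; last exact: BY.
    by rewrite -(addKr e b); apply: lsubD => //; apply: lsubN => //; apply: EX.
  by rewrite addr0.
by split; [rewrite -[e]addr0; apply: mem_add|apply: EX].
Qed.

Lemma add_cap_right E B : lsubspace B -> E `<=` X -> B `<=` Y ->
  E 0 -> (E :+: B) `&` Y = B.
Proof.
move=> sB EX BY E0; apply/seteqP; split=> [_ [[e Ee [b Bb <-]] Yeb]|b Bb].
  have -> : e = 0.
    apply: direct_sum_cap; first exact: EX.
    by rewrite -(addrK b e); apply: lsubB => //; apply: BY.
  by rewrite add0r.
by split; [rewrite -[b]add0r; apply: mem_add|apply: BY].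
Qed.

End DirectSum.

Section DirectSumDim.
Variables (R : realType) (Z : lmodType R[i]) (X Y : set Z).
Hypotheses (sX : lsubspace X) (sY : lsubspace Y).
Hypothesis XY : direct_sum [set: Z] X Y.
Implicit Types E L : set Z.

(** By the modular law, [L] is the direct sum of its trace on [X] and [Y]. *)
Lemma dimq_setIX L : lsubspace L -> Y `<=` L ->
  dimq (L `&` X) [set 0] = dimq L Y.
Proof.
move=> sL YL; rewrite -{2}(setI_add_transversal XY sL YL) dimq_addI//; last first.
  exact: lsubspaceI.
congr dimq; apply/seteqP; split=> [z ->|z [[_ Xz] Yz]] /=.
  by split; [split|]; apply: lsub0.
exact: (direct_sum_cap XY).
Qed.

Lemma dimq_addX E : lsubspace E -> E `<=` X ->
  dimq [set: Z] (E :+: Y) = dimq X E.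
Proof.
move=> sE EX; have sEY := lsubspace_add sE sY.
have -> : [set: Z] = X :+: (E :+: Y).
  apply/seteqP; split=> // z _.
  have [x [y [Xx Yy ->]]] := (direct_sum_add XY z).
  by apply: mem_add => //; apply: sub_addr.
rewrite dimq_addI// setIC (add_cap_left sX XY)//; exact: lsub0.
Qed.

End DirectSumDim.

Section Splitting.
Variables (R : realType) (Z : lmodType R[i]) (w : {skew_hermitian Z}).
Variables X Y : set Z.
Hypotheses (lX : lagrangian w X) (lY : lagrangian w Y).
Hypothesis XY : direct_sum [set: Z] X Y.
Implicit Types U W : set Z.

Let sX : lsubspace X. Proof. by case: lX. Qed.
Let sY : lsubspace Y. Proof. by case: lY. Qed.
Let annX : ann w X = X. Proof. by case: lX. Qed.
Let annY : ann w Y = Y. Proof. by case: lY. Qed.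

Lemma sub_ann_lagrangian W : W `<=` Y -> Y `<=` ann w W.
Proof. by move/(annS (w := w)); rewrite annY. Qed.

(** For [z = x + y] in the left side, [y] annihilates the trace of [W^w] on [X], because [z] and [x]
    do, and it annihilates [Y]. Together these span [W^w], so [y] lies in [W^w^w = W]. *)
Lemma ann_annI W : lsubspace W -> W `<=` Y -> ann_closed w W ->
  ann w (ann w W `&` X) = X :+: W.
Proof.
move=> sW WY cW; have sN := lsubspace_ann w W.
apply/seteqP; split=> [z Az|_ [x Xx [y Wy <-]]].
  have [x [y [Xx Yy zxy]]] := (direct_sum_add XY z).
  rewrite zxy; apply: mem_add => //; rewrite -cW.
  rewrite -(setI_add_transversal XY sN (sub_ann_lagrangian WY)) ann_add//;
    last exact: lsubspaceI.
  split; last by rewrite annY.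
  rewrite (_ : y = z - x); last by rewrite zxy addrC addKr.
  apply: (lsubB (lsubspace_ann w _)) => //.
  by move: Xx; rewrite -{1}annX; apply: annS => ? [].
apply: (lsubD (lsubspace_ann w _)).
  by move: Xx; rewrite -{1}annX; apply: annS => ? [].
by move: Wy; rewrite -{1}cW; apply: annS => ? [].
Qed.

Lemma ann_closed_add W : lsubspace W -> W `<=` Y -> ann_closed w W ->
  ann_closed w (X :+: W).
Proof. by move=> sW WY cW; rewrite -ann_annI//; apply: ann_closed_ann. Qed.

(** The annihilator of the sum is [(X :+: W) & W^w], which the modular law rewrites as the sum
    itself because [W] lies in [W^w]. *)
Lemma lagrangian_add W : lsubspace W -> W `<=` Y -> ann_closed w W ->
  lagrangian w ((ann w W `&` X) :+: W).
Proof.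
move=> sW WY cW; have sN := lsubspace_ann w W.
have sA := lsubspaceI sN sX.
split; first exact: lsubspace_add.
rewrite ann_add// ann_annI// [X :+: W]set_addC set_add_modular//.
  by rewrite set_addC setIC.
exact: (subset_trans WY (sub_ann_lagrangian WY)).
Qed.

(* If Y is in W and W is in U + Y, then W = U & W + Y, and Y pairs with W only
   through U & W. *)
Lemma lagrangian_reduction U W : lsubspace U -> isotropic w U ->
  lsubspace W -> Y `<=` W -> W `<=` U :+: Y ->
  lagrangian_in (reduced_form w W) (reduction w W [set: Z]) (reduction w W U).
Proof.
move=> sU iU sW YW WUY; have sWw := lsubspace_ann w W.
have coW : coisotropic w W.
  by have := annS (w := w) YW; rewrite annY => /subset_trans; apply.
have WA z : W z -> forall y, ann w W y -> w z y = 0 /\ w y z = 0.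
  by move=> Wz y Ay; split; [apply: orthC|]; apply: Ay.
split.
- apply: lsubspace_piv; apply: lsubspace_add => //; exact: lsubspaceI.
- move=> _ [_ [u [Uu Wu] [a Aa <-]] <-]; exists (u + a) => //.
  exact: mem_add.
apply/seteqP; split.
  move=> _ [_ [u [Uu Wu] [a Aa <-]] <-]; split.
    by exists (u + a) => //; apply: mem_add.
  move=> _ [_ [u' [Uu' Wu'] [a' Aa' <-]] <-].
  have [Wa Wa'] := (coW _ Aa, coW _ Aa').
  rewrite reduced_formE//; [|exact: lsubD|exact: lsubD].
  rewrite linearDl !linearDr /= (iU _ Uu _ Uu') (WA _ Wu _ Aa').1.
  by rewrite (WA _ Wu' _ Aa).2 (WA _ Wa _ Aa').1 !addr0.
move=> _ [[_ [z0 [_ Wz0] [a Aa <-]] <-] Hz].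
have Wz : W (z0 + a) by apply: lsubD => //; apply: coW.
have [u Uu [y Yy uyz]] := WUY _ Wz.
have Wy : W y by exact: YW.
have Wu : W u by rewrite -(addrK y u) uyz; apply: lsubB.
(* It remains to see that [y] annihilates [W]. For [z' = u' + y'] in [W], the value at [y'] vanishes
   as [Y] is isotropic; at [u'] it is that of [z0 + a] minus that of [u], zero by the choice of the
   class and by isotropy of [U]. *)
exists (u + y) => //; last by rewrite uyz.
apply: mem_add => // z' Wz'.
have [u' Uu' [y' Yy' uyz']] := WUY _ Wz'.
have Wu' : W u'.
  by rewrite -(addrK y' u') uyz'; apply: lsubB => //; apply: YW.
rewrite -uyz' linearDr /=.
have -> : w y y' = 0 by move: Yy; rewrite -{1}annY; apply.
rewrite addr0 (_ : y = z0 + a - u); last by rewrite -uyz addrC addKr.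
rewrite linearBl /= (iU _ Uu _ Uu') subr0.
rewrite -(reduced_formE coW Wz Wu'); apply: Hz; exists u' => //.
by apply: sub_addl.
Qed.

End Splitting.

(** * Complements *)

Section Complements.
Variables (R : realType) (Z : lmodType R[i]).
Implicit Types A B C E P Q K G : set Z.

(** The span of representatives of a basis of [E/Q]; freeness modulo [Q] makes it meet [Q]
    trivially. *)
Lemma findim_complement E Q : lsubspace E -> lsubspace Q -> Q `<=` E ->
  (dimq E Q < +oo)%E ->
  exists C, [/\ lsubspace C, (dimq C [set 0%R] < +oo)%E & direct_sum E Q C].
Proof.
move=> sE sQ QE /(dimq_fin sQ)[n [e [Ee fe se]]].
pose C := [set x | exists c : 'I_n -> R[i], x = \sum_i c i *: e i].
have sC : lsubspace C.
  apply: lsubspaceP.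
    by exists (fun=> 0); rewrite big1// => i _; rewrite scale0r.
  move=> a _ _ [c ->] [d ->]; exists (fun i => a * c i + d i).
  rewrite scaler_sumr -big_split; apply: eq_bigr => i _ /=.
  by rewrite scalerA scalerDl.
have CE : C `<=` E by move=> _ [c ->]; apply: lsub_comb.
have s0 := lsubspace0 Z.
exists C; split=> //.
  have Cn : has_dim C [set 0] n.
    exists e; split.
    - move=> i; exists (fun j => (j == i)%:R); rewrite (bigD1 i)//= eqxx scale1r.
      by rewrite big1 ?addr0// => j /negbTE->; rewrite scale0r.
    - by move=> c /= c0; apply: fe; rewrite c0; apply: lsub0.
    - by move=> _ [c ->]; exists c; rewrite subrr.
  by rewrite (dimqE s0 Cn) ltry.
split.
  apply/seteqP; split; first exact: add_subset.
  move=> x /se[c Qc]; rewrite -(subrK (\sum_i c i *: e i) x).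
  by apply: mem_add => //; exists c.
apply/seteqP; split=> [x [Qx [c cE]]|_ ->]; last by split; apply: lsub0.
move: Qx; rewrite cE => /fe c0.
by rewrite big1// => i _; rewrite c0 scale0r.
Qed.

Variable w : {skew_hermitian Z}.
Hypothesis w_nd : symplectic w.

(** The algebraic counterpart of a complemented closed subspace, with w-closedness in place of
    topological closedness. *)
Definition closed_complemented E A : Prop :=
  [/\ lsubspace A, A `<=` E, ann_closed w A &
   exists B, [/\ lsubspace B, B `<=` E, ann_closed w B & direct_sum E A B]].

Lemma closed_complemented_codim E Q : lsubspace E -> lsubspace Q -> Q `<=` E ->
  ann_closed w Q -> (dimq E Q < +oo)%E -> closed_complemented E Q.
Proof.
move=> sE sQ QE cQ fin; split=> //.
have [C [sC finC EC]] := findim_complement sE sQ QE fin.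
exists C; split=> //; last by have [] := ann_closed_findim w_nd sC finC.
by have [<- _] := EC; apply: sub_addr.
Qed.

(* If C is a complement of K^w in Z, then C^w is a complement of K. *)
Lemma closed_complemented_findim E K : lsubspace E -> ann_closed w E ->
  lsubspace K -> K `<=` E -> (dimq K [set 0%R] < +oo)%E ->
  closed_complemented E K.
Proof.
move=> sE cE sK KE finK; have [cK dK] := ann_closed_findim w_nd sK finK.
split=> //; have sKw := lsubspace_ann w K.
have [|C [sC finC [TC C0]]] := findim_complement (lsubspaceT Z) sKw (@subsetT _ _).
  by rewrite dK.
have [cC _] := ann_closed_findim w_nd sC finC.
have sCw := lsubspace_ann w C; have sKC := lsubspace_add sK sCw.
have KC0 : K `&` ann w C = [set 0].
  by rewrite -[X in X `&` _]cK -ann_add// TC ann_setT.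
(* This sum is w-closed, being a finite extension of [C^w], and its annihilator [K^w & C] is
   zero. *)
have KCT : K :+: ann w C = [set: Z].
  have finKC : (dimq (K :+: ann w C) (ann w C) < +oo)%E.
    by rewrite dimq_addI// KC0.
  have [<- _] := ann_closed_ext sCw sKC (sub_addr sK) (ann_closed_ann w C) finKC.
  by rewrite ann_add// cC C0 ann_set0.
exists (ann w C `&` E); split=> //.
- exact: lsubspaceI.
- by apply: ann_closedI => //; exact: ann_closed_ann.
split; first by rewrite -set_add_modular// KCT setTI.
apply/seteqP; split=> [z [Kz [Cz _]]|_ ->].
  by have : (K `&` ann w C) z by []; rewrite KC0.
by split; [|split]; apply: lsub0.
Qed.

(** With [G] a w-closed complement of [P & Q] in [E] and [C] a finite-dimensional complement of
    [P :+: Q], the space [(Q & G) :+: C] is a complement of [P]. It is w-closed as a finite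
    extension of a w-closed subspace. *)
Lemma closed_complemented_pair E P Q : lsubspace E -> ann_closed w E ->
  lsubspace P -> P `<=` E -> ann_closed w P ->
  lsubspace Q -> Q `<=` E -> ann_closed w Q ->
  (dimq (P `&` Q) [set 0%R] < +oo)%E -> (dimq E (P :+: Q) < +oo)%E ->
  closed_complemented E P.
Proof.
move=> sE cE sP PE cP sQ QE cQ finK finS; split=> //.
have sK := lsubspaceI sP sQ; have sS := lsubspace_add sP sQ.
have SE : P :+: Q `<=` E by exact: add_subset.
have [C [sC finC [EC C0]]] := findim_complement sE sS SE finS.
have CE : C `<=` E by rewrite -EC; apply: sub_addr.
have [_ _ _ [G [sG GE cG [EG G0]]]] : closed_complemented E (P `&` Q).
  by apply: closed_complemented_findim => // x [/PE].
have sQG := lsubspaceI sQ sG.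
have QGE : Q `&` G `<=` E by move=> x [/QE].
have sB := lsubspace_add sQG sC.
have s0 := lsubspace0 Z.
exists ((Q `&` G) :+: C); split=> //; first exact: add_subset.
  have finB : (dimq ((Q `&` G) :+: C) (Q `&` G) < +oo)%E.
    rewrite set_addC dimq_addI//; apply: le_lt_trans finC.
    apply: dimq_leql => //; first exact: lsubspaceI.
    by move=> x ->; split; [|split]; apply: lsub0.
  by have [] := ann_closed_ext sQG sB (sub_addl sC) (ann_closedI cQ cG) finB.
split.
  apply/seteqP; split; first by apply: add_subset => //; exact: add_subset.
  rewrite -{1}EC => _ [_ [p Pp [q Qq <-]] [c Cc <-]].
  have : E q by exact: QE.
  rewrite -EG => -[k [Pk Qk] [g Gg kgq]].
  (* The component [k] of [q] in [P & Q] is absorbed by [P]. *)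
  have -> : p + q + c = (p + k) + (g + c) by rewrite -kgq !addrA.
  apply: mem_add; first exact: (lsubD sP Pp Pk).
  apply: mem_add => //; split=> //.
  by rewrite -(addKr k g) kgq addrC; apply: lsubB.
apply/seteqP; split=> [p [Pp [g [Qg Gg] [c Cc gcp]]]|_ ->]; last first.
  by split; apply: lsub0.
have c0 : c = 0.
  have : ((P :+: Q) `&` C) c.
    split=> //; rewrite -(addKr g c) gcp addrC.
    by apply: mem_add => //; apply: lsubN.
  by rewrite C0.
have : (P `&` Q `&` G) p by rewrite -gcp c0 addr0 in Pp *.
by rewrite G0.
Qed.

End Complements.

(** * Fredholm pairs in a splitting *)

Section SplittingPair.
Variables (R : realType) (Z : lmodType R[i]) (w : {skew_hermitian Z}).
Variables X Y alpha beta : set Z.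
Hypothesis splitting : lagrangian_splitting_pair w X Y alpha beta.
Local Notation W1 := (alpha `&` Y).
Local Notation W2 := (beta `&` Y).
Local Notation N1 := (ann w W1).
Local Notation N2 := (ann w W2).
Hypothesis fin_cod : (qdim Y (W1 :+: W2) < +oo)%E.

Let w_nd : symplectic w. Proof. by case: splitting. Qed.
Let lX : lagrangian w X. Proof. by case: splitting => _ []. Qed.
Let lY : lagrangian w Y. Proof. by case: splitting => _ []. Qed.
Let XY : direct_sum [set: Z] X Y. Proof. by case: splitting. Qed.
Let lalpha : lagrangian w alpha. Proof. by case: splitting => _ _ _ []. Qed.
Let lbeta : lagrangian w beta. Proof. by case: splitting => _ _ _ []. Qed.
Let sX : lsubspace X. Proof. by case: lX. Qed.
Let sY : lsubspace Y. Proof. by case: lY. Qed.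
Let salpha : lsubspace alpha. Proof. by case: lalpha. Qed.
Let sbeta : lsubspace beta. Proof. by case: lbeta. Qed.
Let annX : ann w X = X. Proof. by case: lX. Qed.
Let annY : ann w Y = Y. Proof. by case: lY. Qed.
Let sT := lsubspaceT Z.
Let s0 := lsubspace0 Z.
Let sW1 : lsubspace W1. Proof. exact: lsubspaceI. Qed.
Let sW2 : lsubspace W2. Proof. exact: lsubspaceI. Qed.
Let sS : lsubspace (W1 :+: W2). Proof. exact: lsubspace_add. Qed.
Let sK : lsubspace (W1 `&` W2). Proof. exact: lsubspaceI. Qed.
Let W1Y : W1 `<=` Y. Proof. by move=> x []. Qed.
Let W2Y : W2 `<=` Y. Proof. by move=> x []. Qed.
Let SY : W1 :+: W2 `<=` Y. Proof. exact: add_subset. Qed.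
Let YN1 : Y `<=` N1. Proof. exact: sub_ann_lagrangian. Qed.
Let YN2 : Y `<=` N2. Proof. exact: sub_ann_lagrangian. Qed.
Let sN1 : lsubspace N1. Proof. exact: lsubspace_ann. Qed.
Let sN2 : lsubspace N2. Proof. exact: lsubspace_ann. Qed.
Let sA1 : lsubspace (N1 `&` X). Proof. exact: lsubspaceI. Qed.
Let sA2 : lsubspace (N2 `&` X). Proof. exact: lsubspaceI. Qed.
Let NY1 : (N1 `&` X) :+: Y = N1. Proof. exact: setI_add_transversal. Qed.
Let NY2 : (N2 `&` X) :+: Y = N2. Proof. exact: setI_add_transversal. Qed.
Let annSE : ann w (W1 :+: W2) = N1 `&` N2. Proof. exact: ann_add. Qed.

Let fin : (dimq Y (W1 :+: W2) < +oo)%E.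
Proof. by rewrite -qdimE. Qed.

Let aY : alpha :+: Y = N1.
Proof. by have [_ _ _ _ ab] := splitting;
  have [] := ann_traces w_nd lY lalpha lbeta ab fin. Qed.
Let bY : beta :+: Y = N2.
Proof. by have [_ _ _ _ ab] := splitting;
  have [] := ann_traces w_nd lY lalpha lbeta ab fin. Qed.

Let equalities : [/\
    ann_closed w (W1 :+: W2), ann_closed w (N1 :+: N2),
    dimq (N1 `&` N2) Y = dimq Y (W1 :+: W2),
    dimq [set: Z] (N1 :+: N2) = dimq (W1 `&` W2) [set 0] &
    (dimq (W1 `&` W2) [set 0%R] < +oo)%E].
Proof.
have [_ _ _ _ ab] := splitting.
have [_] := fredholm_equalities w_nd lY lalpha lbeta ab fin.
by rewrite -(set_add3 salpha sbeta sY) aY bY annSE => ? ? ? [].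
Qed.

(** As [alpha] and [Y] are Lagrangian, [W1] is the annihilator of [alpha :+: Y]. *)
Lemma closed_W1 : ann_closed w W1.
Proof.
have {1}-> : W1 = ann w (alpha :+: Y) by rewrite ann_add// annY; case: lalpha => _ <-.
exact: ann_closed_ann.
Qed.

Lemma closed_W2 : ann_closed w W2.
Proof.
have {1}-> : W2 = ann w (beta :+: Y) by rewrite ann_add// annY; case: lbeta => _ <-.
exact: ann_closed_ann.
Qed.

Lemma sum_domE : ((N1 `&` X) :+: (N2 `&` X)) :+: Y = N1 :+: N2.
Proof. by rewrite -set_add3// NY1 NY2. Qed.

(** Exhibits the sum as an intersection of two w-closed subspaces. *)
Lemma sum_dom_capE : (N1 `&` X) :+: (N2 `&` X) = (N1 :+: N2) `&` X.
Proof.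
rewrite -sum_domE (add_cap_left sX XY)//; first exact: lsubspace_add.
- by apply: add_subset => // x [].
- exact: lsub0.
Qed.

Lemma closed_sum_dom : ann_closed w ((N1 `&` X) :+: (N2 `&` X)).
Proof.
rewrite sum_dom_capE; apply: ann_closedI; last exact: lagrangian_closed.
by have [] := equalities.
Qed.

Lemma codim_sum_dom :
  dimq X ((N1 `&` X) :+: (N2 `&` X)) = dimq (W1 `&` W2) [set 0].
Proof.
rewrite -(dimq_addX sX sY XY); first by rewrite sum_domE; have [] := equalities.
- exact: lsubspace_add.
- by apply: add_subset => // x [].
Qed.

Lemma dim_cap_dom : dimq (N1 `&` N2 `&` X) [set 0] = dimq Y (W1 :+: W2).
Proof.
have [_ _ <- _ _] := equalities; apply: (dimq_setIX sX sY XY).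
  exact: lsubspaceI.
by move=> y Yy; split; [exact: YN1|exact: YN2].
Qed.

(** Serves both for the pair [gamma], [delta] and for the isotropic pair of part (c). *)
Lemma fredholm_of_traces U V : lsubspace U -> lsubspace V ->
  U :+: Y = N1 -> V :+: Y = N2 -> U `&` Y = W1 -> V `&` Y = W2 ->
  fredholm_pair U V /\ fredholm_index U V = 0%E.
Proof.
move=> sU sV UY VY U1 V2; have [_ _ dN dZ finK] := equalities.
have KE : U `&` V `&` Y = W1 `&` W2 by rewrite -U1 -V2 setIACA setIid.
apply: (fredholm_pair_index0 (Y := Y)) => //.
- by rewrite U1 V2 UY VY.
- by rewrite -set_add3// UY VY KE.
- by rewrite UY VY dN.
- by rewrite KE.
Qed.

Lemma trace_add_Y W : lsubspace W -> W `<=` Y ->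
  ((ann w W `&` X) :+: W) :+: Y = ann w W /\
  ((ann w W `&` X) :+: W) `&` Y = W.
Proof.
move=> sW WY; have sN := lsubspace_ann w W; have sA := lsubspaceI sN sX.
split; last first.
  apply: (add_cap_right sY XY) => //; last exact: lsub0.
have WYE : W :+: Y = Y.
  by apply/seteqP; split; [exact: add_subset|exact: sub_addr].
rewrite -set_addA WYE; apply: (setI_add_transversal XY) => //.
exact: sub_ann_lagrangian.
Qed.

Lemma dom_alphaE : relation_dom X Y alpha = N1 `&` X.
Proof. by rewrite relation_domE// aY. Qed.

Lemma dom_betaE : relation_dom X Y beta = N2 `&` X.
Proof. by rewrite relation_domE// bY. Qed.

Lemma splitting_pair_a :
  let gamma := (N1 `&` X) :+: W1 in
  let delta := (N2 `&` X) :+: W2 in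
  (ann_closed w W1 /\ ann_closed w W2 /\
   ann_closed w (X :+: W1) /\ ann_closed w (X :+: W2) /\
   ann_closed w (W1 :+: W2) /\
   ann_closed w ((N1 `&` X) :+: (N2 `&` X)) /\
   ann_closed w (relation_dom X Y alpha) /\
   ann_closed w (relation_dom X Y beta) /\
   ann_closed w (alpha :+: Y) /\ ann_closed w (beta :+: Y)) /\
  (relation_dom X Y alpha = N1 `&` X /\
   relation_dom X Y beta = N2 `&` X /\
   alpha :+: Y = N1 /\ beta :+: Y = N2) /\
  (lagrangian w gamma /\ lagrangian w delta /\
   fredholm_pair gamma delta /\ fredholm_index gamma delta = 0%E) /\
  qdim Y (W1 :+: W2) = vdim (N1 `&` N2 `&` X) /\
  vdim (W1 `&` W2) = qdim X ((N1 `&` X) :+: (N2 `&` X)).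
Proof.
move=> gamma delta; have [cS cN _ _ _] := equalities.
have cN1 : ann_closed w N1 by exact: ann_closed_ann.
have cN2 : ann_closed w N2 by exact: ann_closed_ann.
have cX := lagrangian_closed lX.
have [gY g1] := trace_add_Y sW1 W1Y; have [dY d2] := trace_add_Y sW2 W2Y.
have lg : lagrangian w gamma.
  exact: (lagrangian_add lX lY XY sW1 W1Y closed_W1).
have ld : lagrangian w delta.
  exact: (lagrangian_add lX lY XY sW2 W2Y closed_W2).
split; [|split; [|split; [|split]]].
- do ![split]; rewrite ?aY ?bY ?dom_alphaE ?dom_betaE//.
  + exact: closed_W1.
  + exact: closed_W2.
  + exact: (ann_closed_add lX lY XY sW1 W1Y closed_W1).
  + exact: (ann_closed_add lX lY XY sW2 W2Y closed_W2).
  + exact: closed_sum_dom.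
  + exact: ann_closedI.
  + exact: ann_closedI.
- by rewrite dom_alphaE dom_betaE.
- do 2!split=> //; apply: fredholm_of_traces => //; first by case: lg.
  by case: ld.
- by rewrite vdimE qdimE// dim_cap_dom.
- by rewrite vdimE qdimE ?codim_sum_dom//; exact: lsubspace_add.
Qed.

(** The traces of [N1] and [N2] on [X], as well as [W1] and [W2] in [Y], meet in finite dimension
    and have a sum of finite codimension. So each has a complement by [closed_complemented_pair];
    the intersections and the sums are handled by finite dimension and finite codimension. *)
Lemma splitting_pair_b :
  (closed_complemented w X (N1 `&` X) /\ closed_complemented w X (N2 `&` X) /\
   closed_complemented w X (N1 `&` N2 `&` X) /\
   closed_complemented w X ((N1 `&` X) :+: (N2 `&` X))) /\
  (closed_complemented w Y W1 /\ closed_complemented w Y W2 /\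
   closed_complemented w Y (W1 `&` W2) /\ closed_complemented w Y (W1 :+: W2)).
Proof.
have [cS _ _ _ finK] := equalities.
have cX := lagrangian_closed lX; have cY := lagrangian_closed lY.
have cA1 : ann_closed w (N1 `&` X) by apply: ann_closedI => //; exact: ann_closed_ann.
have cA2 : ann_closed w (N2 `&` X) by apply: ann_closedI => //; exact: ann_closed_ann.
have cW1 := closed_W1; have cW2 := closed_W2.
have AX1 : N1 `&` X `<=` X by move=> x [].
have AX2 : N2 `&` X `<=` X by move=> x [].
have sE := lsubspace_add sA1 sA2.
have EX : (N1 `&` X) :+: (N2 `&` X) `<=` X by exact: add_subset.
have finE : (dimq X ((N1 `&` X) :+: (N2 `&` X)) < +oo)%E by rewrite codim_sum_dom.
have capAE : (N1 `&` X) `&` (N2 `&` X) = N1 `&` N2 `&` X by rewrite setIACA setIid.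
have finA : (dimq ((N1 `&` X) `&` (N2 `&` X)) [set 0%R] < +oo)%E.
  by rewrite capAE dim_cap_dom.
split; (split; [|split; [|split]]).
- exact: (@closed_complemented_pair _ _ _ w_nd _ _ (N2 `&` X)).
- apply: (@closed_complemented_pair _ _ _ w_nd _ _ (N1 `&` X)) => //.
    by rewrite setIC.
  by rewrite set_addC.
- rewrite -capAE; apply: closed_complemented_findim => //.
    exact: lsubspaceI.
  by move=> x [[]].
- apply: closed_complemented_codim => //; exact: closed_sum_dom.
- exact: (@closed_complemented_pair _ _ _ w_nd _ _ W2).
- apply: (@closed_complemented_pair _ _ _ w_nd _ _ W1) => //.
    by rewrite setIC.
  by rewrite set_addC.
- by apply: closed_complemented_findim => // x [[]].
- exact: closed_complemented_codim.
Qed.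

(** * Isotropic relations with prescribed domains *)

Section IsotropicRelations.
Variables U V : set Z.
Hypotheses (sU : lsubspace U) (iU : isotropic w U).
Hypotheses (sV : lsubspace V) (iV : isotropic w V).
Hypotheses (domU : relation_dom X Y U = N1 `&` X).
Hypotheses (domV : relation_dom X Y V = N2 `&` X).
Local Notation W := (ann w (W1 :+: W2)).

Lemma add_of_dom A : lsubspace A -> (relation_dom X Y A) :+: Y = A :+: Y.
Proof.
move=> sA; rewrite relation_domE//; apply: (setI_add_transversal XY).
  exact: lsubspace_add.
exact: sub_addr.
Qed.

Let UY : U :+: Y = N1. Proof. by rewrite -add_of_dom// domU. Qed.
Let VY : V :+: Y = N2. Proof. by rewrite -add_of_dom// domV. Qed.

(** By isotropy, [A & Y] lies in [A^w & Y^w], the annihilator of [A :+: Y], which is [B^w^w = B]. *)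
Lemma isotropic_trace A B : lsubspace A -> isotropic w A -> ann_closed w B ->
  A :+: Y = ann w B -> A `&` Y `<=` B.
Proof.
move=> sA iA cB AY x [Ax Yx]; rewrite -cB -AY ann_add// annY.
by split=> //; apply: iA.
Qed.

Let U1 : U `&` Y `<=` W1.
Proof. exact: isotropic_trace closed_W1 UY. Qed.
Let V2 : V `&` Y `<=` W2.
Proof. exact: isotropic_trace closed_W2 VY. Qed.

(** Any [z] in [A^w] annihilates [B], the trace of [A] on [Y], so [z = a + y] with [a] in [A]. Then
    [y] annihilates both [A] and [Y], hence lies in [B^w^w = B], which is part of [A]. *)
Lemma lagrangian_of_trace A B : lsubspace A -> isotropic w A ->
  ann_closed w B -> A :+: Y = ann w B -> A `&` Y = B -> lagrangian w A.
Proof.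
move=> sA iA cB AY AB; split=> //; apply/seteqP; split=> // z Az.
have : ann w B z by move: Az; apply: (annS (w := w)); rewrite -AB => ? [].
rewrite -AY => -[a Aa [y Yy ayz]]; rewrite -ayz; apply: lsubD => //.
suff : B y by rewrite -AB => -[].
rewrite -cB -AY ann_add// annY; split=> //.
rewrite (_ : y = z - a); last by rewrite -ayz addrC addKr.
exact: (lsubB (lsubspace_ann w A) Az (iA _ Aa)).
Qed.

Lemma splitting_pair_c :
  (N1 = U :+: Y /\ N2 = V :+: Y /\
   (U :+: V) `&` W = (U `&` W) :+: (V `&` W) /\
   U `&` Y `<=` W1 :+: W2 /\ V `&` Y `<=` W1 :+: W2 /\
   vdim (reduction w W [set: Z]) = (2%:R%:E * qdim Y (W1 :+: W2))%E /\
   lagrangian_in (reduced_form w W) (reduction w W [set: Z])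
     (reduction w W U) /\
   lagrangian_in (reduced_form w W) (reduction w W [set: Z])
     (reduction w W V) /\
   U :+: V :+: W = (N1 `&` X) :+: (N2 `&` X) :+: Y /\
   qdim [set: Z] (U :+: V :+: W) = vdim (W1 `&` W2) /\
   (vdim (U `&` V `&` Y) <= vdim (W1 `&` W2))%E) /\
  (W1 :+: W2 `<=` (U `&` Y) :+: (V `&` Y) ->
   vdim (U `&` V `&` Y) = vdim (W1 `&` W2) ->
   (U `&` Y) :+: (V `&` Y) = W1 :+: W2 /\
   lagrangian w U /\ lagrangian w V /\
   fredholm_pair U V /\ fredholm_index U V = 0%E).
Proof.
have [cS cN dN dZ finK] := equalities.
have sW : lsubspace W by exact: lsubspace_ann.
have YW : Y `<=` W by rewrite annSE => y Yy; split; [exact: YN1|exact: YN2].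
have UN1 : U `<=` N1 by rewrite -UY; apply: sub_addl.
have VN2 : V `<=` N2 by rewrite -VY; apply: sub_addl.
have sUV := lsubspace_add sU sV.
have UVW : U :+: V :+: W = N1 :+: N2.
  apply/seteqP; split.
    apply: add_subset; [exact: lsubspace_add| |].
      by move=> _ [u Uu [v Vv <-]]; apply: mem_add; [exact: UN1|exact: VN2].
    by rewrite annSE => z [N1z _]; exact: sub_addl.
  rewrite -UY -VY set_add3// => _ [z UVz [y Yy <-]].
  by apply: mem_add => //; exact: YW.
have KUV : U `&` V `&` Y `<=` W1 `&` W2.
  by move=> z [[Uz Vz] Yz]; split; [exact: U1|exact: V2].
have sKUV : lsubspace (U `&` V `&` Y) by do 2!apply: lsubspaceI => //.
have capW : (U :+: V) `&` W = (U `&` W) :+: (V `&` W).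
  apply/seteqP; split.
    (* As [u] lies in [N1], [v] in [N2] and [u + v] in both, subtraction puts each summand in
       both. *)
    move=> _ [[u Uu [v Vv <-]]]; rewrite annSE => -[N1uv N2uv].
    apply: mem_add; split=> //; split.
    + exact: UN1.
    + by rewrite -(addrK v u); exact: (lsubB sN2 N2uv (VN2 _ Vv)).
    + by rewrite -(addKr u v) addrC; exact: (lsubB sN1 N1uv (UN1 _ Uu)).
    + exact: VN2.
  move=> _ [u [Uu Wu] [v [Vv Wv] <-]]; split; first exact: mem_add.
  exact: (lsubD sW Wu Wv).
have US : U `&` Y `<=` W1 :+: W2 by apply: subset_trans U1 _; exact: sub_addl.
have VS : V `&` Y `<=` W1 :+: W2 by apply: subset_trans V2 _; exact: sub_addr.
have dimW : vdim (reduction w W [set: Z]) = (2%:R%:E * qdim Y (W1 :+: W2))%E.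
  (* Here [W^w] is [W1 :+: W2], and the chain from it through [Y] to [W] has two steps of the same
     finite dimension. *)
  rewrite /reduction cS setTI dimq_piv//; last exact: lsubspace_add.
  rewrite (_ : W :+: (W1 :+: W2) = W); last first.
    apply/seteqP; split; last exact: sub_addl.
    by apply: add_subset => //; exact: subset_trans SY YW.
  rewrite (dimqD sW sY sS SY YW) qdimE// {1}annSE dN.
  have [s Hs] := dimq_fin sS fin.
  by rewrite (dimqE sS Hs) -EFinD -EFinM mulr_natl mulr2n.
have redU : lagrangian_in (reduced_form w W) (reduction w W [set: Z])
    (reduction w W U).
  by apply: (lagrangian_reduction lY) => //; rewrite UY annSE => z [].
have redV : lagrangian_in (reduced_form w W) (reduction w W [set: Z])
    (reduction w W V).
  by apply: (lagrangian_reduction lY) => //; rewrite VY annSE => z [].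
have codimW : qdim [set: Z] (U :+: V :+: W) = vdim (W1 `&` W2).
  by rewrite UVW qdimE ?vdimE//; apply: lsubspace_add.
have UVWE : U :+: V :+: W = (N1 `&` X) :+: (N2 `&` X) :+: Y.
  by rewrite UVW sum_domE.
split.
  do 10?(split; first by []).
  by rewrite !vdimE; apply: dimq_leq => // x ->; exact: lsub0.
rewrite !vdimE => WUV dimE.
have KE : W1 `&` W2 = U `&` V `&` Y.
  apply: (dimq_eq (C := [set 0])) => //; last by rewrite dimE.
  by move=> x ->; apply: lsub0.
have U1E : U `&` Y = W1.
  apply/seteqP; split=> // x W1x.
  (* Since [x] and [u] lie in [W1], so does [v]; thus [v] lies in [W1 & W2], which is part of [U] by
     [KE]. *)
  have [u UYu [v VYv uvx]] := WUV x (sub_addl sW2 W1x).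
  rewrite -uvx; apply: lsubD => //; first exact: lsubspaceI.
  have : (W1 `&` W2) v.
    split; last exact: V2.
    by rewrite -(addKr u v) uvx addrC; apply: lsubB => //; exact: U1.
  by rewrite KE => -[[]].
have V2E : V `&` Y = W2.
  apply/seteqP; split=> // x W2x.
  have [u UYu [v VYv uvx]] := WUV x (sub_addr sW1 W2x).
  rewrite -uvx; apply: lsubD => //; first exact: lsubspaceI.
  have : (W1 `&` W2) u.
    split; first exact: U1.
    by rewrite -(addrK v u) uvx; apply: lsubB => //; exact: V2.
  by rewrite KE => -[[]].
split; first by rewrite U1E V2E.
split; first exact: lagrangian_of_trace closed_W1 UY U1E.
split; first exact: lagrangian_of_trace closed_W2 VY V2E.
exact: fredholm_of_traces.
Qed.

End IsotropicRelations.
End SplittingPair.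

(** * Bounded forms: w-closed subspaces are topologically closed *)

Section BoundedForms.
Variables (R : realType) (Z : completeNormedModType R[i]).
Variable w : {skew_hermitian Z}.
Hypotheses (w_bd : bounded_form w).

(** If [p] in the closure had [w p y] nonzero, a nearby [q] in the annihilator would satisfy
    [w p y = w (p - q) y], too small by boundedness. *)
Lemma closed_ann (A : set Z) : closed (ann w A).
Proof.
have [M wM] := w_bd.
move=> p clp y Ay; apply/eqP; apply: contraT => wpy.
(* The summand 1 keeps [C] positive even when [M] or [y] is zero. *)
set C := `|M| * `|y| + 1.
have C0 : 0 < C by rewrite ltr_wpDl// mulr_ge0.
have e0 : 0 < `|w p y| / C by rewrite divr_gt0// normr_gt0.
have [q [Aq]] := clp _ (nbhsx_ballx p _ e0).
rewrite -ball_normE /= ltr_pdivlMr// => /lt_geF/negbT.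
rewrite -[w p y]subr0 -(Aq _ Ay) -linearBl /=; case/negP.
(* The constant [M] is complex, but the bound forces this product to be nonnegative, so taking norms
   replaces [M] by its modulus. *)
have Mpq0 : 0 <= M * `|p - q| * `|y| := le_trans (normr_ge0 _) (wM _ _).
apply: le_trans (wM _ _) _; rewrite -(ger0_norm Mpq0) !normrM !normr_id.
by rewrite mulrAC mulrC ler_wpM2l// lerDl.
Qed.

Lemma complemented_of_ann_closed (E A : set Z) : closed_complemented w E A ->
  complemented_closed_lsubspace_of E A.
Proof.
move=> [sA AE cA [B [sB BE cB EAB]]].
split; first by split=> //; apply: closed_subspaceW; rewrite -cA; exact: closed_ann.
exists B => //; split=> //; apply: closed_subspaceW; rewrite -cB.
exact: closed_ann.
Qed.

End BoundedForms.

Unset Implicit Arguments.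

Theorem theorem4p18 (R : realType) :
  (forall (Z : lmodType R[i]) (w : {skew_hermitian Z})
          (X Y alpha beta : set Z),
    lagrangian_splitting_pair w X Y alpha beta ->
    let W1 := alpha `&` Y in
    let W2 := beta `&` Y in
    let gamma := (ann w W1 `&` X) :+: W1 in
    let delta := (ann w W2 `&` X) :+: W2 in
    (qdim Y (W1 :+: W2) < +oo)%E ->
    (* (a) *)
    ((ann_closed w W1 /\ ann_closed w W2 /\
      ann_closed w (X :+: W1) /\ ann_closed w (X :+: W2) /\
      ann_closed w (W1 :+: W2) /\
      ann_closed w ((ann w W1 `&` X) :+: (ann w W2 `&` X)) /\
      ann_closed w (relation_dom X Y alpha) /\
      ann_closed w (relation_dom X Y beta) /\
      ann_closed w (alpha :+: Y) /\ ann_closed w (beta :+: Y)) /\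
     (relation_dom X Y alpha = ann w W1 `&` X /\
      relation_dom X Y beta = ann w W2 `&` X /\
      alpha :+: Y = ann w W1 /\ beta :+: Y = ann w W2) /\
     (lagrangian w gamma /\ lagrangian w delta /\
      fredholm_pair gamma delta /\ fredholm_index gamma delta = 0%E) /\
     qdim Y (W1 :+: W2) = vdim (ann w W1 `&` ann w W2 `&` X) /\
     vdim (W1 `&` W2) = qdim X ((ann w W1 `&` X) :+: (ann w W2 `&` X))) /\
    (* (c) *)
    (let W := ann w (W1 :+: W2) in
     forall U V : set Z,
       lsubspace U -> isotropic w U -> lsubspace V -> isotropic w V ->
       relation_dom X Y U = ann w W1 `&` X ->
       relation_dom X Y V = ann w W2 `&` X ->
       (ann w W1 = U :+: Y /\ ann w W2 = V :+: Y /\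
        (U :+: V) `&` W = (U `&` W) :+: (V `&` W) /\
        U `&` Y `<=` W1 :+: W2 /\ V `&` Y `<=` W1 :+: W2 /\
        vdim (reduction w W [set: Z]) = (2%:R%:E * qdim Y (W1 :+: W2))%E /\
        lagrangian_in (reduced_form w W) (reduction w W [set: Z])
          (reduction w W U) /\
        lagrangian_in (reduced_form w W) (reduction w W [set: Z])
          (reduction w W V) /\
        U :+: V :+: W = (ann w W1 `&` X) :+: (ann w W2 `&` X) :+: Y /\
        qdim [set: Z] (U :+: V :+: W) = vdim (W1 `&` W2) /\
        (vdim (U `&` V `&` Y) <= vdim (W1 `&` W2))%E) /\
       (W1 :+: W2 `<=` (U `&` Y) :+: (V `&` Y) ->
        vdim (U `&` V `&` Y) = vdim (W1 `&` W2) ->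
        (U `&` Y) :+: (V `&` Y) = W1 :+: W2 /\
        lagrangian w U /\ lagrangian w V /\
        fredholm_pair U V /\ fredholm_index U V = 0%E))) /\
  (* (b) *)
  (forall (Z : completeNormedModType R[i]) (w : {skew_hermitian Z})
          (X Y alpha beta : set Z),
    bounded_form w ->
    lagrangian_splitting_pair w X Y alpha beta ->
    let W1 := alpha `&` Y in
    let W2 := beta `&` Y in
    (qdim Y (W1 :+: W2) < +oo)%E ->
    (complemented_closed_lsubspace_of X (ann w W1 `&` X) /\
     complemented_closed_lsubspace_of X (ann w W2 `&` X) /\
     complemented_closed_lsubspace_of X (ann w W1 `&` ann w W2 `&` X) /\
     complemented_closed_lsubspace_of X
       ((ann w W1 `&` X) :+: (ann w W2 `&` X))) /\
    (complemented_closed_lsubspace_of Y W1 /\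
     complemented_closed_lsubspace_of Y W2 /\
     complemented_closed_lsubspace_of Y (W1 `&` W2) /\
     complemented_closed_lsubspace_of Y (W1 :+: W2))).

Proof.
split.
  move=> Z w X Y alpha beta H W1 W2 gamma delta fin.
  split; first exact: (splitting_pair_a H fin).
  move=> W U V sU iU sV iV domU domV.
  exact: (splitting_pair_c H fin).
move=> Z w X Y alpha beta w_bd H W1 W2 fin.
have [[b1 [b2 [b3 b4]]] [b5 [b6 [b7 b8]]]] := splitting_pair_b H fin.
by split; (split; [|split; [|split]]); apply: (complemented_of_ann_closed w_bd).
Qed.
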